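(* Let $(\mathfrak{A},\mathsf{L})$ be a Lipschitz pair with $\mathfrak{A}$ unital, with unit $1$. An Abelian C*-subalgebra $\mathfrak{M}$ of $\mathfrak{A}$ is a topography for $\mathfrak{A}$ (i.e. $(\mathfrak{A},\mathfrak{M})$ is a topographic quantum space) if and only if $\mathfrak{M}$ is unital with the same unit as $\mathfrak{A}$, and the following are equivalent: (1) $(\mathfrak{A},\mathsf{L})$ is a compact quantum metric space; (2) $(\mathfrak{A},\mathsf{L},\mathbb{C}1)$ is a quantum locally compact metric space; (3) for all Abelian C*-subalgebras $\mathfrak{M}$ of $\mathfrak{A}$ with $1\in\mathfrak{M}$, the Lipschitz triple $(\mathfrak{A},\mathsf{L},\mathfrak{M})$ is a quantum locally compact separable metric space; (4) there exists an Abelian C*-subalgebra $\mathfrak{M}$ of $\mathfrak{A}$ with $1\in\mathfrak{M}$ such that the Lipschitz triple $(\mathfrak{A},\mathsf{L},\mathfrak{M})$ is a quantum locally compact metric space; (5) for all strictly positive elements $h\in\mathfrak{A}$, the Lipschitz triple $(\mathfrak{A},\mathsf{L},C^\ast(h))$ is a quantum locally compact separable metric space; (6) there exists a strictly positive element $h\in\mathfrak{A}$ such that the Lipschitz triple $(\mathfrak{A},\mathsf{L},C^\ast(h))$ is a quantum locally compact metric space.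
   Context: For a C*-algebra $\mathfrak{A}$: $\mathfrak{u}\mathfrak{A}$ is $\mathfrak{A}$ if $\mathfrak{A}$ is unital and its standard unitization $\mathfrak{A}\oplus\mathbb{C}$ otherwise, with unit $1$; $\mathfrak{sa}(\cdot)$ denotes self-adjoint elements; $\mathscr{S}(\mathfrak{A})$ is the state space; each state is identified with its unique extension to a state of $\mathfrak{u}\mathfrak{A}$ and with its normal extension to the von Neumann algebra $\mathfrak{A}^{\ast\ast}$ (which contains $\mathfrak{u}\mathfrak{A}$). The weak* topology is $\sigma(\mathfrak{A}^\ast,\mathfrak{A})$. A positive element $h$ is strictly positive when $\varphi(h)>0$ for every state $\varphi$; $C^\ast(h)$ is the C*-subalgebra generated by $h$. A Lipschitz pair $(\mathfrak{A},\mathsf{L})$ is a C*-algebra $\mathfrak{A}$ with a seminorm $\mathsf{L}$ defined on a dense subspace of $\mathfrak{sa}(\mathfrak{u}\mathfrak{A})$ such that $\{a\in\mathfrak{sa}(\mathfrak{u}\mathfrak{A}):\mathsf{L}(a)=0\}=\mathbb{R}1$ (writing $\mathsf{L}(a)\leq 1$ presumes $a$ is in the domain). The extended Monge-Kantorovich metric is $\mathsf{mk}_{\mathsf{L}}(\varphi,\psi)=\sup\{|\varphi(a)-\psi(a)|:a\in\mathfrak{sa}(\mathfrak{A}),\ \mathsf{L}(a)\leq1\}\in[0,\infty]$ for $\varphi,\psi\in\mathscr{S}(\mathfrak{A})$. For a state $\mu$, $\mathfrak{L}_1(\mathfrak{A},\mathsf{L},\mu)=\{a\in\mathfrak{sa}(\mathfrak{u}\mathfrak{A}):\mathsf{L}(a)\leq1\text{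 and }\mu(a)=0\}$. A Lipschitz pair $(\mathfrak{A},\mathsf{L})$ with $\mathfrak{A}$ unital is a compact quantum metric space (in the sense of Rieffel) when $\mathscr{S}(\mathfrak{A})$ has finite diameter for $\mathsf{mk}_{\mathsf{L}}$ and the image of $\{a\in\mathfrak{sa}(\mathfrak{A}):\mathsf{L}(a)\leq1\}$ under the quotient map $\mathfrak{A}\to\mathfrak{A}/\mathbb{C}1$ is precompact for the quotient norm; equivalently (Rieffel), $\mathsf{mk}_{\mathsf{L}}$ metrizes the weak* topology on $\mathscr{S}(\mathfrak{A})$. A topographic quantum space $(\mathfrak{A},\mathfrak{M})$ is a C*-algebra $\mathfrak{A}$ with an Abelian C*-subalgebra $\mathfrak{M}$ (called the topography) containing an approximate identity for $\mathfrak{A}$. $\sigma(\mathfrak{M})$ is the Gel'fand spectrum of $\mathfrak{M}$; $\mathcal{K}(\sigma(\mathfrak{M}))$ is the set of its compact subsets, directed so that larger sets come later; for $K\in\mathcal{K}(\sigma(\mathfrak{M}))$, $\chi_K$ is the indicator function of $K$, a projection in $\mathfrak{M}^{\ast\ast}\subseteq\mathfrak{A}^{\ast\ast}$. Set $\mathscr{S}(\mathfrak{A}|K)=\{\varphi\in\mathscr{S}(\mathfrak{A}):\varphi(\chi_K)=1\}$ and $\mathscr{S}(\mathfrak{A}|\mathfrak{M})=\bigcup_{K\in\mathcal{K}(\sigma(\mathfrak{M}))}\mathscr{S}(\mathfrak{A}|K)$ (local states). A Lipschitz triple $(\mathfrak{A},\mathsf{L},\mathfrak{M})$ is a Lipschitz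 pair $(\mathfrak{A},\mathsf{L})$ together with an Abelian C*-subalgebra $\mathfrak{M}$ such that $(\mathfrak{A},\mathfrak{M})$ is a topographic quantum space. It is regular when every $\mathscr{S}(\mathfrak{A}|K)$, $K\in\mathcal{K}(\sigma(\mathfrak{M}))$, has finite diameter for $\mathsf{mk}_{\mathsf{L}}$. A subset $\mathscr{K}\subseteq\mathscr{S}(\mathfrak{A})$ is tame when, for some $\mu\in\mathscr{S}(\mathfrak{A}|\mathfrak{M})$, $\lim_{K\in\mathcal{K}(\sigma(\mathfrak{M}))}\sup\{|\varphi(a-\chi_Ka\chi_K)|:a\in\mathfrak{L}_1(\mathfrak{A},\mathsf{L},\mu),\varphi\in\mathscr{K}\}=0$. A quantum locally compact metric space is a regular Lipschitz triple such that, for every tame $\mathscr{K}\subseteq\mathscr{S}(\mathfrak{A})$, the topology of $(\mathscr{K},\mathsf{mk}_{\mathsf{L}})$ is the relative weak* topology on $\mathscr{K}$; it is a quantum locally compact separable metric space when moreover $\mathfrak{A}$ is separable. *)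

(* Defs.v *)
From HB Require Import structures.
From mathcomp Require Import all_boot all_order all_algebra.
From mathcomp Require Import complex.
From mathcomp Require Import all_classical all_reals all_analysis.

Set Implicit Arguments.
Unset Strict Implicit.
Unset Printing Implicit Defensive.

Import Order.TTheory GRing.Theory Num.Theory.
Import numFieldNormedType.Exports.

Local Open Scope classical_set_scope.
Local Open Scope ring_scope.

(* Naming the structure of [R[i]] makes the norm topology, which the library
   attaches to any [numClosedFieldType], available on the complex numbers. *)
Definition cplx (R : realType) : numClosedFieldType := R[i]%C.

Definition of_real (R : realType) (t : R) : cplx R := real_complex R t.

Definition re (R : realType) (z : cplx R) : R := complex.Re z.

(* Norms of elements of a normed module over [cplx R] are complex numbers;
   [rnorm] is the same norm with values in [R]. *)
Definition rnorm (R : realType) (V : normedModType (cplx R)) (v : V) : R :=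
  re `|v|.

Definition cabs (R : realType) (z : cplx R) : R := re `|z|.

(* The product is part of this interface, and not inherited from the algebra
   structures of [ssralg], because [NumDomain] was declared without the join of
   rings and normed modules, so that Hierarchy Builder rejects that join. *)
HB.mixin Record isUnitalCStarAlgebra (C : numClosedFieldType) A
    of CompleteNormedModule C A := {
  cmul : A -> A -> A ;
  cone : A ;
  cstar : A -> A ;
  cmulA : associative cmul ;
  cmul1l : left_id cone cmul ;
  cmul1r : right_id cone cmul ;
  cmulDl : forall x y z, cmul (x + y) z = cmul x z + cmul y z ;
  cmulDr : forall x y z, cmul x (y + z) = cmul x y + cmul x z ;
  cmulZl : forall (k : C) x y, cmul (k *: x) y = k *: cmul x y ;
  cmulZr : forall (k : C) x y, cmul x (k *: y) = k *: cmul x y ;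
  cstarK : involutive cstar ;
  cstarD : forall x y, cstar (x + y) = cstar x + cstar y ;
  cstarZ : forall (k : C) x, cstar (k *: x) = k^* *: cstar x ;
  cstarM : forall x y, cstar (cmul x y) = cmul (cstar y) (cstar x) ;
  ler_norm_cmul : forall x y, `|cmul x y| <= `|x| * `|y| ;
  cstar_identity : forall x, `|cmul (cstar x) x| = `|x| ^+ 2 }.

#[short(type="unitalCStarAlgType")]
HB.structure Definition UnitalCStarAlgebra (C : numClosedFieldType) :=
  { A of CompleteNormedModule C A & isUnitalCStarAlgebra C A }.

Notation "x *c y" := (cmul x y) (at level 40, left associativity) : ring_scope.
Notation "1c" := cone (at level 0) : ring_scope.

Section CStarAlgebras.
Variables (R : realType) (A : unitalCStarAlgType (cplx R)).
Implicit Types (a b h x y : A) (M : set A).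

Definition sa : set A := [set a | cstar a = a].

Definition cpos : set A := [set a | exists b, a = cstar b *c b].

Definition separable : Prop := exists2 D : set A, countable D & dense D.

Record cstar_subalgebra M : Prop := {
  subalg0 : M 0 ;
  subalgD : forall x y, M x -> M y -> M (x + y) ;
  subalgZ : forall (k : cplx R) x, M x -> M (k *: x) ;
  subalgM : forall x y, M x -> M y -> M (x *c y) ;
  subalg_star : forall x, M x -> M (cstar x) ;
  subalg_closed : closed M }.

Definition abelian M : Prop := forall x y, M x -> M y -> x *c y = y *c x.

Definition cstar_generated h : set A := smallest cstar_subalgebra [set h].

Definition scalars : set A := range (fun k : cplx R => k *: 1c).

Definition tails (I : Type) (le : I -> I -> Prop) : set_system I :=
  filter_from setT (fun i => [set j | le i j]).

(* An increasing net of positive contractions of [M], indexed by a nonempty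
   directed preorder. *)
Definition has_approximate_identity M : Prop :=
  exists (I : Type) (le : I -> I -> Prop) (e : I -> A),
    [/\ inhabited I,
        [/\ forall i, le i i,
            forall i j k, le i j -> le j k -> le i k &
            forall i j, exists k, le i k /\ le j k],
        [/\ forall i, M (e i), forall i, cpos (e i),
            forall i, rnorm (e i) <= 1 &
            forall i j, le i j -> cpos (e j - e i)] &
        forall a, (e i *c a @[i --> tails le] --> a) /\
                  (a *c e i @[i --> tails le] --> a)].

Definition topographic M : Prop :=
  [/\ cstar_subalgebra M, abelian M & has_approximate_identity M].

Definition dual_norm (phi : A -> cplx R) : \bar R :=
  ereal_sup [set (cabs (phi a))%:E | a in [set a | rnorm a <= 1]].

Definition state : set (A -> cplx R) :=
  [set phi | [/\ scalar phi, forall a, 0 <= phi (cstar a *c a) &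
                 dual_norm phi = 1%:E]].

Definition strictly_positive h : Prop :=
  cpos h /\ forall phi, state phi -> 0 < phi h.

(* The Gel'fand spectrum of [M].  Since [M] is a mere set of elements of [A],
   the algebraic conditions are stated through the inclusion [set_val]. *)
Definition spectrum M : set (M -> cplx R) :=
  [set chi | [/\ forall (k : cplx R) (x y z : M),
                   set_val z = k *: set_val x + set_val y ->
                   chi z = k * chi x + chi y,
                 forall x y z : M,
                   set_val z = set_val x *c set_val y ->
                   chi z = chi x * chi y &
                 exists m : M, chi m != 0]].

Definition compact_spectrum M : set (set (M -> cplx R)) :=
  [set K | K `<=` spectrum (M := M) /\
           compact (K : set {ptws M -> cplx R})].

(* The bidual of [A] with its (first) Arens product is the enveloping von
   Neumann algebra of [A] (Sherman-Takeda).  Its elements are represented by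
   functions on all of [A -> cplx R], of which only the values at bounded
   linear functionals are meaningful; if [psi] is bounded linear and [G] is in
   the bidual, then so are the functionals [psi (a *c _)] and
   [fun a => G (psi (a *c _))] below.  The normal extension of a state [phi] to
   the bidual is the evaluation [F |-> F phi]. *)
Definition bidual : Type := (A -> cplx R) -> cplx R.

Definition to_bidual a : bidual := fun psi => psi a.

Definition arens (F G : bidual) : bidual :=
  fun psi => F (fun a => G (fun b => psi (a *c b))).

Definition above M (K : set (M -> cplx R)) : set M :=
  [set f | forall chi, spectrum chi -> \1_K chi <= chi f].

(* The indicator function of a compact subset [K] of the spectrum of [M], as an
   element of M** contained in A**: it is the weak* limit of the decreasing net
   of those elements of [M] whose Gel'fand transform dominates it.  Its value at
   a functional psi is m(K), where m is the regular complex Borel measure on the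
   spectrum that represents the restriction of psi to [M]. *)
Definition indicator M (K : set (M -> cplx R)) : bidual :=
  fun psi => lim (psi (set_val f) @[f --> filter_from (above K)
    (fun g => [set f | above K f /\
                       forall chi, spectrum chi -> chi f <= chi g])]).

Definition states_on M (K : set (M -> cplx R)) : set (A -> cplx R) :=
  [set phi | state phi /\ indicator K phi = 1].

Definition local_states M : set (A -> cplx R) :=
  \bigcup_(K in compact_spectrum (M := M)) states_on K.

End CStarAlgebras.

Arguments sa {R} A.
Arguments separable {R} A.
Arguments scalars {R} A.
Arguments state {R} A.
Arguments spectrum {R A} M.
Arguments compact_spectrum {R A} M.

Section LipschitzPairs.
Variables (R : realType) (A : unitalCStarAlgType (cplx R)).

(* [A] being unital, its unitization is [A] itself.  The values of [lip] outside
   of [ldom] are irrelevant. *)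
Record lipschitz_pair := LipschitzPair {
  ldom : set A ;
  lip : A -> R ;
  ldom_sa : ldom `<=` sa A ;
  ldom0 : ldom 0 ;
  ldomD : forall a b, ldom a -> ldom b -> ldom (a + b) ;
  ldomZ : forall (t : R) a, ldom a -> ldom (of_real t *: a) ;
  ldom_dense : sa A `<=` closure ldom ;
  lip_ge0 : forall a, ldom a -> 0 <= lip a ;
  lipD : forall a b, ldom a -> ldom b -> lip (a + b) <= lip a + lip b ;
  lipZ : forall (t : R) a, ldom a -> lip (of_real t *: a) = `|t| * lip a ;
  lip_eq0 : [set a | ldom a /\ lip a = 0] =
            range (fun t : R => of_real t *: (1c : A)) }.

Variable L : lipschitz_pair.
Implicit Types (phi psi mu : A -> cplx R) (S : set (A -> cplx R)).

Definition lip_ball : set A := [set a | ldom L a /\ lip L a <= 1].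

Definition lip_ball_at mu : set A := [set a | lip_ball a /\ mu a = 0].

Definition mk phi psi : \bar R :=
  ereal_sup [set (cabs (phi a - psi a))%:E | a in lip_ball].

Definition finite_diameter S : Prop :=
  (ereal_sup [set mk phi psi | phi in S & psi in S] < +oo)%E.

(* The quotient norm, in A/C1, of the class of [a]. *)
Definition quotient_norm (a : A) : R :=
  inf (range (fun k : cplx R => rnorm (a + k *: 1c))).

Definition compact_quantum_metric_space : Prop :=
  finite_diameter (state A) /\
  forall e : R, 0 < e -> exists2 F : set A, finite_set F &
    lip_ball `<=` \bigcup_(b in F) [set a | quotient_norm (a - b) < e].

Definition mk_open S (U : set (A -> cplx R)) : Prop :=
  forall phi, U phi -> exists2 e : R, 0 < e &
    forall psi, S psi -> (mk phi psi < e%:E)%E -> U psi.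

Definition weak_star_open S (U : set (A -> cplx R)) : Prop :=
  exists2 V : set {ptws A -> cplx R}, open V & U = V `&` S.

Definition mk_metrizes_weak_star S : Prop :=
  forall U, U `<=` S -> (mk_open S U <-> weak_star_open S U).

Variable M : set A.

Definition tail S mu (K : set (M -> cplx R)) : \bar R :=
  ereal_sup
    [set (cabs (phi a -
            arens (arens (indicator K) (to_bidual a)) (indicator K) phi))%:E
    | a in lip_ball_at mu & phi in S].

Definition tame S : Prop :=
  S `<=` state A /\
  exists2 mu, local_states M mu &
    forall e : R, 0 < e -> exists2 K0, compact_spectrum M K0 &
      forall K, compact_spectrum M K -> K0 `<=` K -> (tail S mu K < e%:E)%E.

Definition regular : Prop :=
  forall K : set (M -> cplx R),
    compact_spectrum M K -> finite_diameter (states_on K).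

Definition quantum_locally_compact_metric_space : Prop :=
  [/\ topographic M, regular & forall S, tame S -> mk_metrizes_weak_star S].

Definition quantum_locally_compact_separable_metric_space : Prop :=
  quantum_locally_compact_metric_space /\ separable A.

End LipschitzPairs.

(* Main.v *)
Require Import Defs.
From HB Require Import structures.
From mathcomp Require Import all_boot all_order all_algebra.
From mathcomp Require Import complex ring lra.
From mathcomp Require Import all_classical all_reals all_analysis.

(** A unital abelian subalgebra [M] has a compact spectrum, and the indicator of the
    whole spectrum is the unit of the bidual.  So the state space is itself one of the
    sets of states concentrated on a compact set, and it is tame, because cutting down
    by the unit changes nothing.  For such an [M], local compactness therefore says that
    the state space has finite diameter and that the metric induces the weak* topology
    on it; this no longer depends on [M], and by Rieffel's theorem it characterizes
    compact quantum metric spaces.  Conversely, in a compact quantum metric space the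
    metric induces the weak* topology on every set of states, and the algebra is
    separable, whatever [M] is.  A strictly positive [h] only enters through the fact
    that its C*-algebra contains the unit.

    Both directions of Rieffel's theorem are short.  If the unit ball of the seminorm is
    totally bounded modulo scalars, the values of a state at a finite net control the
    metric ([compact_quantum_metrizes]).  If the metric induces the weak* topology,
    finitely many small metric balls cover the weak* compact state space, and the values
    at their centres, which are bounded, cut the unit ball into finitely many small
    pieces ([lip_ball_totally_bounded]).

    The second direction needs states to compute the norm of self-adjoint elements, and
    the identification of the indicator needs characters of [M] to separate points.
    Both rest on positivity.  The positive cone is defined by a norm condition that makes
    it convex; square roots come from the contraction principle, and Kaplansky's theorem
    that [b* b] is positive ([pos_starM]) from growth estimates for powers, where the
    C*-identity plays the part of the spectral radius formula.  The Hahn-Banach theorem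
    for the functional [upper] then gives the states ([state_norming]), and also the
    lower bound [h >= s > 0] for strictly positive [h]
    ([strictly_positive_bounded_below]), from which the unit is a limit of polynomials
    in [h] without constant term.  Finally, a state with value one at a self-adjoint
    element [g] of norm one shows that the squares and [g - 1/2] generate a proper
    preordering of the real algebra of self-adjoint elements of [M]; a maximal
    preordering that contains it is a total order, and the standard part for this order
    is a character that does not vanish at [g] ([gelfand_injective]). *)

Set Implicit Arguments.
Unset Strict Implicit.
Unset Printing Implicit Defensive.

Import Order.TTheory GRing.Theory Num.Theory.
Import numFieldNormedType.Exports.

Local Open Scope classical_set_scope.
Local Open Scope ring_scope.

(** * Complex numbers and norms, measured by real numbers *)

Section ComplexNumbers.
Variable R : realType.
Implicit Types (t s : R) (z w : cplx R).

Local Notation C := (cplx R).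

Lemma re_of_real t : re (of_real t) = t. Proof. by []. Qed.

Lemma of_real_re z : 0 <= z -> of_real (re z) = z.
Proof. by move=> z0; apply: RRe_real; exact: ger0_real. Qed.

Lemma of_realD t s : of_real (t + s) = of_real t + of_real s.
Proof. exact: (rmorphD (real_complex R)). Qed.
Lemma of_realN t : of_real (- t) = - of_real t.
Proof. exact: (rmorphN (real_complex R)). Qed.
Lemma of_realB t s : of_real (t - s) = of_real t - of_real s.
Proof. exact: (rmorphB (real_complex R)). Qed.
Lemma of_realM t s : of_real (t * s) = of_real t * of_real s.
Proof. exact: (rmorphM (real_complex R)). Qed.
Lemma of_real0 : of_real 0 = 0 :> C. Proof. by []. Qed.
Lemma of_real1 : of_real 1 = 1 :> C. Proof. by []. Qed.

Lemma of_real_le t s : (of_real t <= of_real s) = (t <= s).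
Proof. exact: lecR. Qed.
Lemma of_real_lt t s : (of_real t < of_real s) = (t < s).
Proof. exact: ltcR. Qed.
Lemma of_real_inj : injective (@of_real R).
Proof. exact: complexI. Qed.

Lemma conj_of_real t : (of_real t)^* = of_real t.
Proof. by apply: CrealP; apply/complex_realP; exists t. Qed.

Lemma re_ge0 z : 0 <= z -> 0 <= re z.
Proof. by move=> z0; rewrite -of_real_le (of_real_re z0). Qed.

Lemma reD z w : re (z + w) = re z + re w.
Proof. by case: z w => [? ?] [? ?]. Qed.
Lemma reN z : re (- z) = - re z. Proof. by case: z. Qed.
Lemma reB z w : re (z - w) = re z - re w. Proof. by rewrite reD reN. Qed.
Lemma reZ t z : re (of_real t * z) = t * re z.
Proof. by case: z => ? ? /=; rewrite /re /= mul0r subr0. Qed.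

Lemma norm_cabs z : `|z| = of_real (cabs z).
Proof. by rewrite /cabs of_real_re. Qed.

Lemma cabs_ge0 z : 0 <= cabs z. Proof. exact: re_ge0. Qed.

Lemma cabsM z w : cabs (z * w) = cabs z * cabs w.
Proof. by apply: of_real_inj; rewrite of_realM -!norm_cabs normrM. Qed.

Lemma cabsD z w : cabs (z + w) <= cabs z + cabs w.
Proof. by rewrite -of_real_le of_realD -!norm_cabs ler_normD. Qed.

Lemma cabsN z : cabs (- z) = cabs z. Proof. by rewrite /cabs normrN. Qed.

Lemma cabsC z w : cabs (z - w) = cabs (w - z).
Proof. by rewrite -cabsN opprB. Qed.

Lemma cabs_of_real t : cabs (of_real t) = `|t|.
Proof.
apply: of_real_inj; rewrite -norm_cabs.
have [t0|t0] := leP 0 t; first by rewrite !ger0_norm // (of_real_le 0).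
by rewrite !ltr0_norm // ?of_realN // (of_real_lt _ 0).
Qed.

Lemma cabs0 : cabs (0 : C) = 0.
Proof. by rewrite -of_real0 cabs_of_real normr0. Qed.

Lemma cabs1 : cabs (1 : C) = 1.
Proof. by rewrite -of_real1 cabs_of_real normr1. Qed.

Lemma cabs_eq0 z : cabs z = 0 -> z = 0.
Proof. by move=> z0; apply/eqP; rewrite -normr_eq0 norm_cabs z0. Qed.

Lemma mul_conj_cabs z : z * z^* = of_real (cabs z ^+ 2).
Proof. by rewrite -normCK norm_cabs expr2 -of_realM -expr2. Qed.

Lemma re_le_cabs z : `|re z| <= cabs z.
Proof. by rewrite -of_real_le -norm_cabs; exact: normc_ge_Re. Qed.

Lemma cabs_i : cabs ('i : C) = 1.
Proof. by apply: of_real_inj; rewrite -norm_cabs normCi. Qed.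

Lemma im_le_cabs z : `|complex.Im z| <= cabs z.
Proof.
have -> : complex.Im z = - re ('i%C * z).
  by case: z => a b; rewrite /re /=; ring.
by rewrite normrN (le_trans (re_le_cabs _)) // cabsM [cabs 'i%C]cabs_i mul1r.
Qed.

Lemma cabs_le_reim z : cabs z <= `|re z| + `|complex.Im z|.
Proof.
have -> : cabs z = cabs (of_real (re z) + 'i%C * of_real (complex.Im z)).
  by congr cabs; exact: complexE.
rewrite (le_trans (cabsD _ _)) // cabsM !cabs_of_real.
by rewrite [cabs 'i%C]cabs_i mul1r.
Qed.

Lemma real_of_realE z : z^* = z -> z = of_real (re z).
Proof.
move=> zr; apply/esym/RRe_real; exact/CrealP.
Qed.

End ComplexNumbers.

Section RealNorm.
Variables (R : realType) (V : normedModType (cplx R)).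
Implicit Types (x y : V) (k : cplx R).

Lemma norm_rnorm x : `|x| = of_real (rnorm x).
Proof. by rewrite /rnorm of_real_re. Qed.

Lemma rnorm_ge0 x : 0 <= rnorm x. Proof. exact: re_ge0. Qed.

Lemma rnormD x y : rnorm (x + y) <= rnorm x + rnorm y.
Proof. by rewrite -of_real_le of_realD -!norm_rnorm ler_normD. Qed.

Lemma rnormN x : rnorm (- x) = rnorm x. Proof. by rewrite /rnorm normrN. Qed.

Lemma rnormC x y : rnorm (x - y) = rnorm (y - x).
Proof. by rewrite -rnormN opprB. Qed.

Lemma rnormB x y : rnorm (x - y) <= rnorm x + rnorm y.
Proof. by rewrite (le_trans (rnormD _ _)) // rnormN. Qed.

Lemma rnorm_trans y x z : rnorm (x - z) <= rnorm (x - y) + rnorm (y - z).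
Proof. by rewrite (le_trans _ (rnormD _ _)) // addrA subrK. Qed.

Lemma rnormZ k x : rnorm (k *: x) = cabs k * rnorm x.
Proof.
by apply: of_real_inj; rewrite of_realM -norm_cabs -!norm_rnorm normrZ.
Qed.

Lemma rnorm0 : rnorm (0 : V) = 0. Proof. by rewrite /rnorm normr0. Qed.

Lemma rnorm_eq0 x : rnorm x = 0 -> x = 0.
Proof. by move=> x0; apply/eqP; rewrite -normr_eq0 norm_rnorm x0. Qed.

Lemma nbhs_rnormP x (P : set V) :
  nbhs x P <-> exists2 e : R, 0 < e & forall y, rnorm (x - y) < e -> P y.
Proof.
split=> [/nbhs_ballP[e e0 xP]|[e e0 xP]].
  have er : of_real (re e) = e by rewrite of_real_re // ltW.
  exists (re e); first by rewrite -of_real_lt er.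
  move=> y xy; apply: xP; rewrite -ball_normE /= norm_rnorm -er.
  by rewrite of_real_lt.
apply/nbhs_ballP; exists (of_real e); first by rewrite /= (of_real_lt 0).
by move=> y; rewrite -ball_normE /= norm_rnorm of_real_lt => /xP.
Qed.

Lemma closure_rnorm (M : set V) x :
  closure M x <-> forall e : R, 0 < e -> exists2 y, M y & rnorm (x - y) < e.
Proof.
split=> [clx e e0|approx B /nbhs_rnormP[e e0 xB]].
  have [y [My xy]] := clx _ ((nbhs_rnormP _ [set y | rnorm (x - y) < e]).2
    (ex_intro2 _ _ e e0 (fun y H => H))).
  by exists y.
by have [y My xy] := approx e e0; exists y; split => //; exact: xB.
Qed.

Lemma closed_rnorm (M : set V) :
  closed M <->
  forall x, (forall e : R, 0 < e -> exists2 y, M y & rnorm (x - y) < e) -> M x.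
Proof.
split=> [clM x /closure_rnorm/clM //|H x /closure_rnorm]; exact: H.
Qed.

End RealNorm.

Section Limits.
Variables (R : realType) (V : completeNormedModType (cplx R)).

Lemma rnorm_cauchy (x : nat -> V) :
  (forall e : R, 0 < e -> exists N, forall m n, (N <= m)%N -> (N <= n)%N ->
     rnorm (x m - x n) < e) ->
  exists l, forall e : R, 0 < e -> exists N, forall n, (N <= n)%N ->
     rnorm (x n - l) < e.
Proof.
move=> cau.
have cv : cvg (x @ \oo).
  apply/cauchy_cvgP/cauchy_ballP => e e0; near_simpl.
  have er : of_real (re e) = e by rewrite of_real_re // ltW.
  have re0 : 0 < re e by rewrite -of_real_lt er.
  have [N xN] := cau _ re0.
  exists ([set n | (N <= n)%N], [set n | (N <= n)%N]).
    by split; exists N.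
  move=> [m n] [/= Nm Nn]; rewrite -ball_normE /= norm_rnorm -er of_real_lt.
  exact: xN.
exists (lim (x @ \oo)) => e e0.
have /cvgrPdist_lt/(_ (of_real e)) := cv.
rewrite (of_real_lt 0) => /(_ e0)[N _ xN]; exists N => n Nn.
by have /= := xN n Nn; rewrite norm_rnorm of_real_lt rnormC.
Qed.

Lemma geometric_small (r D e : R) : 0 <= r -> r < 1 -> 0 < e ->
  exists N, forall n, (N <= n)%N -> r ^+ n * D < e.
Proof.
move=> r0 r1 e0.
have : (fun n => r ^+ n * D) @ \oo --> 0 * D.
  by apply: cvgMr_tmp; apply: cvg_expr; rewrite ger0_norm.
rewrite mul0r => /cvgrPdist_lt/(_ _ e0)[N _ HN]; exists N => n Nn.
by apply: le_lt_trans (HN n Nn); rewrite /= sub0r normrN ler_norm.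
Qed.

(** Banach's contraction principle. *)
Lemma contraction_fixpoint (U : set V) (f : V -> V) (r : R) x0 :
  closed U -> U x0 -> 0 <= r -> r < 1 -> (forall x, U x -> U (f x)) ->
  (forall x y, U x -> U y -> rnorm (f x - f y) <= r * rnorm (x - y)) ->
  exists2 x, U x & f x = x.
Proof.
move=> clU Ux0 r0 r1 fU fr.
pose x n := iter n f x0.
have Ux n : U (x n) by elim: n => //= n; exact: fU.
have step n : rnorm (x n.+1 - x n) <= r ^+ n * rnorm (x 1%N - x 0%N).
  elim: n => [|n IH]; first by rewrite expr0 mul1r.
  rewrite exprS -mulrA; apply: (le_trans (fr _ _ (Ux n.+1) (Ux n))).
  by rewrite ler_wpM2l.
set D := rnorm (x 1%N - x 0%N) in step.
have r1' : 0 < 1 - r by rewrite subr_gt0.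
have dist n k : rnorm (x (n + k)%N - x n) * (1 - r) <= r ^+ n * D.
  have H : rnorm (x (n + k)%N - x n) * (1 - r) <= (r ^+ n - r ^+ (n + k)) * D.
    elim: k => [|k IH]; first by rewrite addn0 !subrr rnorm0 !mul0r.
    have := rnorm_trans (x (n + k)%N) (x (n + k.+1)%N) (x n).
    rewrite addnS => tri; have := step (n + k)%N.
    rewrite exprS; set p := r ^+ (n + k) in IH *; set q := r ^+ n in IH *.
    move=> st; nra.
  apply: le_trans H _; rewrite ler_wpM2r ?rnorm_ge0 // gerBl exprn_ge0 //.
have [|l xl] := rnorm_cauchy (x := x).
  move=> e e0; have [|N HN] := @geometric_small r D (e / 2 * (1 - r)) r0 r1.
    by rewrite mulr_gt0 // divr_gt0.
  have near n : (N <= n)%N -> rnorm (x n - x N) < e / 2.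
    move=> /subnKC <-; rewrite -(ltr_pM2r r1').
    exact: le_lt_trans (dist _ _) (HN N _).
  exists N => m n Nm Nn.
  rewrite (le_lt_trans (rnorm_trans (x N) _ _)) // (rnormC (x N)).
  by rewrite (splitr e) ltrD ?near.
have Ul : U l.
  move/closed_rnorm: clU; apply => e /xl[N HN]; exists (x N) => //.
  by rewrite rnormC HN.
exists l => //.
apply/eqP; rewrite -subr_eq0; apply/eqP/rnorm_eq0/eqP.
rewrite eq_le rnorm_ge0 andbT; apply/ler_addgt0Pl => e e0; rewrite addr0.
have [|N HN] := xl (e / 2); first by rewrite divr_gt0.
apply: le_trans (rnorm_trans (x N.+1) _ _) _; rewrite (splitr e) lerD //.
  rewrite (le_trans (fr _ _ Ul (Ux N))) //.
  rewrite rnormC; apply: le_trans (ltW (HN N (leqnn _))).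
  by rewrite ler_piMl ?rnorm_ge0 // ltW.
by rewrite ltW // HN.
Qed.

End Limits.
(** * Algebra and norms in a unital C*-algebra *)

Section StarAlgebra.
Variables (R : realType) (A : unitalCStarAlgType (cplx R)).
Implicit Types (x y z a b : A) (k : cplx R) (t s : R) (n : nat).

Lemma cmul0l x : 0 *c x = 0 :> A.
Proof. by apply: (addrI (0 *c x)); rewrite -cmulDl !addr0. Qed.
Lemma cmul0r x : x *c 0 = 0 :> A.
Proof. by apply: (addrI (x *c 0)); rewrite -cmulDr !addr0. Qed.
Lemma cmulNl x y : - x *c y = - (x *c y).
Proof. by apply: (addrI (x *c y)); rewrite -cmulDl !subrr cmul0l. Qed.
Lemma cmulNr x y : x *c - y = - (x *c y).
Proof. by apply: (addrI (x *c y)); rewrite -cmulDr !subrr cmul0r. Qed.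
Lemma cmulBl x y z : (x - y) *c z = x *c z - y *c z.
Proof. by rewrite cmulDl cmulNl. Qed.
Lemma cmulBr x y z : x *c (y - z) = x *c y - x *c z.
Proof. by rewrite cmulDr cmulNr. Qed.

Lemma cstar0 : cstar 0 = 0 :> A.
Proof. by apply: (addrI (cstar 0)); rewrite -cstarD !addr0. Qed.
Lemma cstarN x : cstar (- x) = - cstar x.
Proof. by apply: (addrI (cstar x)); rewrite -cstarD !subrr cstar0. Qed.
Lemma cstarB x y : cstar (x - y) = cstar x - cstar y.
Proof. by rewrite cstarD cstarN. Qed.
Lemma cstar1 : cstar 1c = 1c :> A.
Proof. by rewrite -[LHS]cmul1r -{2}(cstarK (1c : A)) -cstarM cmul1r cstarK. Qed.

(** Real multiples of the unit, against which the order and the norm are measured. *)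
Definition sc t : A := of_real t *: 1c.

Lemma scD t s : sc (t + s) = sc t + sc s.
Proof. by rewrite /sc of_realD scalerDl. Qed.
Lemma scN t : sc (- t) = - sc t.
Proof. by rewrite /sc of_realN scaleNr. Qed.
Lemma scB t s : sc (t - s) = sc t - sc s.
Proof. by rewrite scD scN. Qed.
Lemma sc0 : sc 0 = 0. Proof. by rewrite /sc of_real0 scale0r. Qed.
Lemma sc1 : sc 1 = 1c. Proof. by rewrite /sc of_real1 scale1r. Qed.
Lemma scM t s : sc (t * s) = of_real t *: sc s.
Proof. by rewrite /sc scalerA of_realM. Qed.
Lemma cmul_sc t x : sc t *c x = of_real t *: x.
Proof. by rewrite cmulZl cmul1l. Qed.
Lemma cmul_scr t x : x *c sc t = of_real t *: x.
Proof. by rewrite cmulZr cmul1r. Qed.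

Lemma saD a b : sa A a -> sa A b -> sa A (a + b).
Proof. by rewrite /sa /= cstarD => -> ->. Qed.
Lemma saN a : sa A a -> sa A (- a).
Proof. by rewrite /sa /= cstarN => ->. Qed.
Lemma saB a b : sa A a -> sa A b -> sa A (a - b).
Proof. by move=> ? ?; apply/saD/saN. Qed.
Lemma saZ t a : sa A a -> sa A (of_real t *: a).
Proof. by rewrite /sa /= cstarZ conj_of_real => ->. Qed.
Lemma sa1 : sa A 1c. Proof. exact: cstar1. Qed.
Lemma sa_sc t : sa A (sc t). Proof. exact/saZ/sa1. Qed.
Lemma saM a b : sa A a -> sa A b -> a *c b = b *c a -> sa A (a *c b).
Proof. by rewrite /sa /= cstarM => -> -> ->. Qed.
Lemma sa_starM x : sa A (cstar x *c x).
Proof. by rewrite /sa /= cstarM cstarK. Qed.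
Lemma rnormM x y : rnorm (x *c y) <= rnorm x * rnorm y.
Proof. by rewrite -of_real_le of_realM -!norm_rnorm ler_norm_cmul. Qed.

Lemma rnorm_starM x : rnorm (cstar x *c x) = rnorm x ^+ 2.
Proof.
apply: of_real_inj; rewrite -norm_rnorm cstar_identity norm_rnorm.
by rewrite expr2 -of_realM -expr2.
Qed.

Lemma rnorm_cstar x : rnorm (cstar x) = rnorm x.
Proof.
have le y : rnorm y <= rnorm (cstar y).
  have := rnorm_ge0 y; rewrite le0r => /predU1P[->|y0]; first exact: rnorm_ge0.
  by rewrite -(ler_pM2r y0) -expr2 -rnorm_starM rnormM.
by apply/eqP; rewrite eq_le le -{2}(cstarK x) le.
Qed.

Lemma rnorm_saM a : sa A a -> rnorm (a *c a) = rnorm a ^+ 2.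
Proof. by move=> {1}<-; exact: rnorm_starM. Qed.

Lemma rnorm1_le1 : rnorm (1c : A) <= 1.
Proof.
have := rnorm_saM sa1; rewrite cmul1l => e.
by have := rnorm_ge0 (1c : A); nra.
Qed.

Lemma rnorm_sc t : rnorm (sc t) <= `|t|.
Proof.
by rewrite rnormZ cabs_of_real ler_piMr // rnorm1_le1.
Qed.

Lemma rnormZr t x : rnorm (of_real t *: x) = `|t| * rnorm x.
Proof. by rewrite rnormZ cabs_of_real. Qed.

(** Real and imaginary parts. *)
Definition hre x : A := of_real 2^-1 *: (x + cstar x).
Definition him x : A := of_real 2^-1 *: ('i *: (cstar x - x)).

Lemma sa_hre x : sa A (hre x).
Proof. by apply: saZ; rewrite /sa /= cstarD cstarK addrC. Qed.
Lemma sa_him x : sa A (him x).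
Proof.
by apply: saZ; rewrite /sa /= cstarZ conjCi cstarB cstarK scaleNr -scalerN opprB.
Qed.

Lemma halve_double x : of_real 2^-1 *: (x + x) = x.
Proof.
rewrite -{1 2}(scale1r x) -scalerDl scalerA -of_real1 -of_realD -of_realM.
by rewrite (_ : _ * _ = 1) ?scale1r //; field.
Qed.

Lemma hre_him x : x = hre x + 'i *: him x.
Proof.
rewrite /him (scalerA 'i) mulrC -scalerA (scalerA 'i 'i) -expr2 sqrCi scaleN1r opprB.
by rewrite -scalerDr addrACA subrr addr0 halve_double.
Qed.

Lemma hre_sa a : sa A a -> hre a = a.
Proof. by rewrite /hre => ->; exact: halve_double. Qed.
Lemma him_sa a : sa A a -> him a = 0.
Proof. by rewrite /him => ->; rewrite subrr !scaler0. Qed.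

Lemma hreD x y : hre (x + y) = hre x + hre y.
Proof. by rewrite /hre cstarD addrACA scalerDr. Qed.
Lemma himD x y : him (x + y) = him x + him y.
Proof. by rewrite /him cstarD opprD addrACA !scalerDr. Qed.
Lemma hreZ t x : hre (of_real t *: x) = of_real t *: hre x.
Proof. by rewrite /hre cstarZ conj_of_real -scalerDr !scalerA mulrC. Qed.
Lemma himZ t x : him (of_real t *: x) = of_real t *: him x.
Proof.
rewrite /him cstarZ conj_of_real -scalerBr !scalerA.
by congr (_ *: _); rewrite mulrC mulrA.
Qed.
Lemma hreN x : hre (- x) = - hre x.
Proof. by rewrite /hre cstarN -opprD scalerN. Qed.
Lemma hrei x : hre ('i *: x) = - him x.
Proof.
by rewrite /hre /him cstarZ conjCi scaleNr -scalerBr -scalerN -scalerN opprB.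
Qed.
Lemma himi x : him ('i *: x) = hre x.
Proof.
rewrite /hre /him cstarZ conjCi scaleNr -opprD -scalerDr scalerN scalerA -expr2.
by rewrite sqrCi scaleN1r opprK addrC.
Qed.

Lemma rnorm_hre x : rnorm (hre x) <= rnorm x.
Proof.
rewrite rnormZr ger0_norm ?invr_ge0 //.
have := rnormD x (cstar x); rewrite rnorm_cstar; lra.
Qed.
Definition cpow x n : A := iter n (cmul x) 1c.

Lemma cpowS x n : cpow x n.+1 = x *c cpow x n. Proof. by []. Qed.

Lemma cpowSr x n : cpow x n.+1 = cpow x n *c x.
Proof.
elim: n => [|n IH]; first by rewrite /= cmul1l cmul1r.
by rewrite [LHS]cpowS {1}IH cmulA -cpowS.
Qed.

Lemma cpowD x m n : cpow x (m + n) = cpow x m *c cpow x n.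
Proof. by elim: m => [|m IH]; rewrite ?cmul1l // addSn !cpowS IH cmulA. Qed.

Lemma cpow_comm x y n : x *c y = y *c x -> cpow x n *c y = y *c cpow x n.
Proof.
move=> xy; elim: n => [|n IH]; first by rewrite cmul1l cmul1r.
by rewrite cpowS -cmulA IH cmulA xy cmulA.
Qed.

Lemma sa_cpow x n : sa A x -> sa A (cpow x n).
Proof.
move=> sx; elim: n => [|n IH]; first exact: sa1.
by apply: saM => //; rewrite -cpow_comm.
Qed.

Lemma rnorm_cpow x n : rnorm (cpow x n) <= rnorm x ^+ n.
Proof.
elim: n => [|n IH]; first by rewrite expr0 rnorm1_le1.
by rewrite exprS (le_trans (rnormM _ _)) // ler_wpM2l // rnorm_ge0.
Qed.

Lemma rnorm_cpow2 x m : sa A x -> rnorm (cpow x (2 ^ m)) = rnorm x ^+ (2 ^ m).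
Proof.
move=> sx; elim: m => [|m IH]; first by rewrite /= cmul1r expr1.
rewrite expnSr muln2 -addnn cpowD rnorm_saM; last exact: sa_cpow.
by rewrite IH -exprM muln2 addnn.
Qed.

Lemma cpow_intertwine x y z n :
  x *c y = z *c x -> x *c cpow y n = cpow z n *c x.
Proof.
move=> xyz; elim: n => [|n IH]; first by rewrite cmul1l cmul1r.
by rewrite cpowSr cmulA IH -cmulA xyz cmulA -cpowSr.
Qed.

(** If [r > 1], then [r ^ N] exceeds [1 + N d] with [d = r - 1], so [r ^ (2 N)] grows
    at least quadratically in [N] and eventually exceeds any linear bound. *)
Lemma linear_growth (r K : R) :
  0 <= r -> (forall m, r ^+ (2 ^ m) <= K * (2 ^ m).+1%:R) -> r <= 1.
Proof.
move=> r0 H; rewrite leNgt; apply/negP => r1.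
pose d := r - 1; have d0 : 0 < d by rewrite subr_gt0.
have bern n : 1 + n%:R * d <= r ^+ n.
  elim: n => [|n IH]; first by rewrite mul0r addr0 expr0.
  rewrite exprS -natr1.
  have : 0 <= n%:R * d by rewrite mulr_ge0 // ltW.
  by move: IH; rewrite (_ : r = 1 + d); [|rewrite /d; ring]; nra.
have K0 : 0 <= K.
  have := H 0%N; rewrite expn0 expr1; lra.
have bound m : (2 ^ m)%:R * d ^+ 2 <= 3 * K.
  have := H m.+1; rewrite expnSr exprM => Hm.
  have := bern (2 ^ m)%N; set N := (2 ^ m)%N in Hm *.
  have N1 : 1 <= N%:R :> R by rewrite ler1n /N expn_gt0.
  rewrite -natr1 natrM in Hm.
  move=> bN.
  have : (N%:R * d) ^+ 2 <= 3 * K * N%:R.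
    have : 0 <= N%:R * d by rewrite mulr_ge0 // ltW.
    by nra.
  move=> sq; have N0 : 0 < N%:R :> R by lra.
  by rewrite -(ler_pM2r N0); apply: le_trans sq; rewrite exprMn; lra.
have [m Hm] : exists m, 3 * K < (2 ^ m)%:R * d ^+ 2.
  exists (Num.truncn (3 * K / d ^+ 2)).+1.
  have d2 : 0 < d ^+ 2 by rewrite exprn_gt0.
  rewrite -ltr_pdivrMr //.
  apply: lt_trans (truncnS_gt _) _; rewrite ltr_nat; exact: ltn_expl.
by have := bound m; rewrite leNgt Hm.
Qed.

(** By the C*-identity the powers of a self-adjoint element of exponent [2 ^ m] have
    exactly the powers of its norm as norms, so growth bounds on powers bound the norm
    itself.  This replaces the spectral radius formula. *)
Lemma rnorm_le_growth a (T K : R) : sa A a -> 0 < T ->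
  (forall n, rnorm (cpow a n) <= K * n.+1%:R * T ^+ n) -> rnorm a <= T.
Proof.
move=> sx T0 H.
suff : rnorm a / T <= 1 by rewrite ler_pdivrMr // mul1r.
apply: (@linear_growth _ K); first by rewrite divr_ge0 ?rnorm_ge0 // ltW.
move=> m; by rewrite expr_div_n -rnorm_cpow2 // ler_pdivrMr ?exprn_gt0.
Qed.

End StarAlgebra.
(** * Subalgebras, and abelian subalgebras as commutative rings *)

Section Subalgebras.
Variables (R : realType) (A : unitalCStarAlgType (cplx R)).
Implicit Types (x y z a b : A) (M : set A) (k : cplx R).

Lemma subalgN M x : cstar_subalgebra M -> M x -> M (- x).
Proof. by move=> hM Mx; rewrite -scaleN1r; exact: subalgZ. Qed.

Lemma subalgB M x y : cstar_subalgebra M -> M x -> M y -> M (x - y).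
Proof. by move=> hM Mx My; apply: subalgD => //; exact: subalgN. Qed.

Lemma subalg_hre M x : cstar_subalgebra M -> M x -> M (hre x).
Proof.
move=> hM Mx; apply: (subalgZ hM); apply: (subalgD hM) => //.
exact: subalg_star.
Qed.

Lemma subalg_him M x : cstar_subalgebra M -> M x -> M (him x).
Proof.
move=> hM Mx; apply: (subalgZ hM); apply: (subalgZ hM).
by apply: subalgB => //; exact: subalg_star.
Qed.

Lemma subalg_sc M (t : R) : cstar_subalgebra M -> M 1c -> M (sc A t).
Proof. by move=> hM M1; exact: subalgZ. Qed.

Lemma closed_sa : closed (sa A).
Proof.
apply/closed_rnorm => x approx; apply/eqP; rewrite -subr_eq0; apply/eqP/rnorm_eq0.
apply/eqP; rewrite eq_le rnorm_ge0 andbT; apply/ler_addgt0Pl => e e0.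
have [|y sy xy] := approx (e / 2); first by rewrite divr_gt0.
rewrite addr0 (le_trans (rnorm_trans y _ _)) // (splitr e) lerD //; last first.
  by rewrite rnormC ltW.
by rewrite -[y in _ - y]sy -cstarB rnorm_cstar ltW.
Qed.

Lemma closed_commutant y : closed [set x | x *c y = y *c x].
Proof.
apply/closed_rnorm => x approx; apply/eqP; rewrite -subr_eq0; apply/eqP/rnorm_eq0.
apply/eqP; rewrite eq_le rnorm_ge0 andbT; apply/ler_addgt0Pl => e e0.
have y1 : 0 < rnorm y + 1 by rewrite ltr_pwDr // rnorm_ge0.
have [|z /= zy xz] := approx (e / (2 * (rnorm y + 1))); first by rewrite divr_gt0 // mulr_gt0.
rewrite addr0 (_ : _ - _ = (x - z) *c y - y *c (x - z)); last first.
  by rewrite cmulBl cmulBr zy opprB addrA subrK.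
have lt : rnorm (x - z) * rnorm y <= e / 2.
  apply: (@le_trans _ _ (rnorm (x - z) * (rnorm y + 1))).
    by rewrite ler_wpM2l ?rnorm_ge0 // lerDl.
  rewrite -ler_pdivlMr // -mulrA -invfM; exact: ltW.
rewrite (le_trans (rnormB _ _)) // (splitr e) lerD //.
  exact: le_trans (rnormM _ _) _.
by apply: le_trans (rnormM _ _) _; rewrite mulrC.
Qed.

Lemma cstar_subalgebra_commutant (S : set A) :
  (forall x, S x -> S (cstar x)) ->
  cstar_subalgebra [set x | forall y, S y -> x *c y = y *c x].
Proof.
move=> Sstar; split=> /=.
- by move=> y _; rewrite cmul0l cmul0r.
- by move=> x z Hx Hz y Sy; rewrite cmulDl cmulDr Hx // Hz.
- by move=> k x Hx y Sy; rewrite cmulZl cmulZr Hx.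
- by move=> x z Hx Hz y Sy; rewrite -cmulA Hz // cmulA Hx // cmulA.
- move=> x Hx y Sy; rewrite -{1}(cstarK y) -cstarM -Hx; last exact: Sstar.
  by rewrite cstarM cstarK.
- apply/closed_rnorm => x approx y Sy.
  have /closed_rnorm := @closed_commutant y; apply => e /approx[z Hz xz].
  by exists z => //; exact: Hz.
Qed.

Lemma cstar_subalgebra_smallest (S : set A) :
  cstar_subalgebra (smallest (@cstar_subalgebra R A) S).
Proof.
split=> [B [hB SB]|x y Mx My B [hB SB]|k x Mx B [hB SB]|x y Mx My B [hB SB]|x Mx B [hB SB]|].
- exact: subalg0.
- by apply: subalgD => //; [exact: Mx|exact: My].
- by apply: subalgZ => //; exact: Mx.
- by apply: subalgM => //; [exact: Mx|exact: My].
- by apply: subalg_star => //; exact: Mx.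
- apply/closed_rnorm => x approx B [hB SB].
  have /closed_rnorm := Defs.subalg_closed hB; apply => e /approx[z Hz xz].
  by exists z => //; exact: Hz.
Qed.

(** A family that is closed under the involution and commutes generates an
    abelian algebra: it lies in its commutant, hence in its bicommutant. *)
Lemma abelian_smallest (S : set A) :
  (forall x, S x -> S (cstar x)) -> abelian S ->
  abelian (smallest (@cstar_subalgebra R A) S).
Proof.
move=> Sstar abS.
set M := smallest _ _; have hM : cstar_subalgebra M by exact: cstar_subalgebra_smallest.
have MS x y : M x -> S y -> x *c y = y *c x.
  move=> Mx; apply: (Mx [set x | forall y, S y -> x *c y = y *c x]); split.
    exact: cstar_subalgebra_commutant.
  by move=> z Sz y' Sy'; exact: abS.
move=> x y Mx My; suff : y *c x = x *c y by [].
apply: (My [set y | forall x, M x -> y *c x = x *c y]) => //; split.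
  by apply: cstar_subalgebra_commutant => z; exact: subalg_star.
by move=> z Sz x' Mx'; apply/esym/MS.
Qed.

End Subalgebras.

(** Bundled, so that the elements of such a subalgebra form a commutative ring: this
    makes identities between commuting elements provable by ring normalization, and
    lets the theory of preorderings apply. *)
Record comm_subalg (R : realType) (A : unitalCStarAlgType (cplx R)) := CommSubalg {
  comm_set : set A ;
  comm_subalgP : cstar_subalgebra comm_set ;
  comm_abelian : abelian comm_set ;
  comm_one : comm_set 1c }.

Definition carrier (R : realType) (A : unitalCStarAlgType (cplx R))
  (N : comm_subalg A) : Type := set_type (comm_set N).

Section CommRing.
Variables (R : realType) (A : unitalCStarAlgType (cplx R)) (N : comm_subalg A).
Local Notation B := (carrier N).
Implicit Types x y z : B.

HB.instance Definition _ := Choice.copy B {x : A | x \in comm_set N}.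

Definition cval (x : B) : A := set_val (x : set_type (comm_set N)).

Lemma cvalP x : comm_set N (cval x). Proof. exact: set_mem (valP _). Qed.

Lemma cval_inj : injective cval.
Proof. by move=> x y /(@val_inj _ _ {x : A | x \in comm_set N}). Qed.

Definition cmk (a : A) (Na : comm_set N a) : B := exist _ a (mem_set Na).

Lemma cmkK a (Na : comm_set N a) : cval (cmk Na) = a. Proof. by []. Qed.

Let hN := comm_subalgP N.
Definition c0 : B := cmk (subalg0 hN).
Definition c1 : B := cmk (comm_one N).
Definition cadd x y : B := cmk (subalgD hN (cvalP x) (cvalP y)).
Definition copp x : B := cmk (subalgN hN (cvalP x)).
Definition cmulc x y : B := cmk (subalgM hN (cvalP x) (cvalP y)).

Fact caddA : associative cadd.
Proof. by move=> x y z; apply: cval_inj; exact: addrA. Qed.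
Fact caddC : commutative cadd.
Proof. by move=> x y; apply: cval_inj; exact: addrC. Qed.
Fact cadd0 : left_id c0 cadd.
Proof. by move=> x; apply: cval_inj; exact: add0r. Qed.
Fact caddN : left_inverse c0 copp cadd.
Proof. by move=> x; apply: cval_inj; exact: addNr. Qed.
Fact cmulcA : associative cmulc.
Proof. by move=> x y z; apply: cval_inj; exact: cmulA. Qed.
Fact cmulcC : commutative cmulc.
Proof. by move=> x y; apply: cval_inj; exact: comm_abelian (cvalP _) (cvalP _). Qed.
Fact cmulc1 : left_id c1 cmulc.
Proof. by move=> x; apply: cval_inj; exact: cmul1l. Qed.
Fact cmulcD : left_distributive cmulc cadd.
Proof. by move=> x y z; apply: cval_inj; exact: cmulDl. Qed.

HB.instance Definition _ := GRing.isZmodule.Build B caddA caddC cadd0 caddN.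
HB.instance Definition _ :=
  GRing.Zmodule_isComPzRing.Build B cmulcA cmulcC cmulc1 cmulcD.

Lemma cvalD x y : cval (x + y) = cval x + cval y. Proof. by []. Qed.
Lemma cvalN x : cval (- x) = - cval x. Proof. by []. Qed.
Lemma cvalB x y : cval (x - y) = cval x - cval y. Proof. by []. Qed.
Lemma cvalM x y : cval (x * y) = cval x *c cval y. Proof. by []. Qed.
Lemma cval1 : cval 1 = 1c. Proof. by []. Qed.

Lemma cvalX x n : cval (x ^+ n) = cpow (cval x) n.
Proof. by elim: n => [|n IH]; rewrite ?expr0 // exprS cvalM IH. Qed.

Definition creal (t : R) : B := cmk (subalg_sc t hN (comm_one N)).

Lemma creal_sub : {morph creal : t s / t - s}.
Proof. by move=> t s; apply: cval_inj; exact: scB. Qed.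
Lemma creal_mul : {morph creal : t s / t * s}.
Proof. by move=> t s; apply: cval_inj; rewrite cvalM !cmkK cmul_sc scM. Qed.
Lemma creal_one : creal 1 = 1.
Proof. by apply: cval_inj; exact: sc1. Qed.

HB.instance Definition _ := GRing.isZmodMorphism.Build R B creal creal_sub.
HB.instance Definition _ :=
  GRing.isMonoidMorphism.Build R B creal (creal_one, creal_mul).

End CommRing.
(** * The positive cone *)

Section Positivity.
Variables (R : realType) (A : unitalCStarAlgType (cplx R)).
Implicit Types (x y z a b : A) (M : set A) (t s e : R).

Local Notation sc := (sc A).

(** The root is [1 - y], where [y] is the fixed point of [y |-> (x + y^2) / 2], which
    is a contraction of ratio [|x|] on the ball of radius [|x|]. *)
Lemma sqrt_one_sub M x : cstar_subalgebra M -> M 1c -> M x -> sa A x ->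
  rnorm x < 1 -> exists q, [/\ M q, sa A q & q *c q = 1c - x].
Proof.
move=> hM M1 Mx sx x1; set r := rnorm x in x1.
have r0 : 0 <= r by exact: rnorm_ge0.
pose U := [set y | [/\ M y, sa A y & rnorm y <= r]].
pose f y := of_real 2^-1 *: (x + y *c y).
have half (v : A) : rnorm (of_real 2^-1 *: v) = rnorm v / 2.
  by rewrite rnormZr mulrC ger0_norm // invr_ge0.
have [||||y [My sy yr] fy] := @contraction_fixpoint _ _ U f r x _ _ r0 x1.
- apply/closed_rnorm => v approx; split.
  + have /closed_rnorm := Defs.subalg_closed hM; apply => e /approx[y [? _ _] ?].
    by exists y.
  + have /closed_rnorm := @closed_sa R A; apply => e /approx[y [_ ? _] ?].
    by exists y.
  + apply/ler_addgt0Pl => e /approx[y [_ _ yr] vy].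
    have := rnormD (v - y) y; rewrite subrK; lra.
- by split.
- move=> y [My sy yr]; split.
  + by apply: (subalgZ hM); apply: (subalgD hM) => //; exact: subalgM.
  + by apply: saZ; apply: saD => //; exact: saM.
  + rewrite half; have := rnormD x (y *c y); rewrite (rnorm_saM sy) -/r.
    have := rnorm_ge0 y; nra.
- move=> y z [_ _ yr] [_ _ zr].
  rewrite /f -scalerBr half opprD addrACA subrr add0r.
  have -> : y *c y - z *c z = y *c (y - z) + (y - z) *c z.
    by rewrite cmulBl cmulBr addrA subrK.
  have := rnormD (y *c (y - z)) ((y - z) *c z).
  have := rnormM y (y - z); have := rnormM (y - z) z.
  have := rnorm_ge0 (y - z); nra.
exists (1c - y); split.
- exact: subalgB.
- exact: saB (@sa1 _ _) sy.
- have yy : y + y = x + y *c y.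
    by rewrite -{1 2}fy /f -scalerDr halve_double.
  have -> : x = y + y - y *c y by rewrite yy addrK.
  rewrite cmulBl !cmulBr !cmul1l cmul1r !opprB addrACA [RHS]addrA.
  by rewrite opprD.
Qed.

(** The existential radius makes sums and positive multiples of positive elements
    visibly positive, without square roots or spectra. *)
Definition pos a : Prop := sa A a /\ exists t, rnorm (sc t - a) <= t.

Lemma pos_mono a t s : rnorm (sc t - a) <= t -> t <= s -> rnorm (sc s - a) <= s.
Proof.
move=> at_ ts; have := rnormD (sc (s - t)) (sc t - a).
rewrite scB addrA subrK.
have := rnorm_sc A (s - t); rewrite scB ger0_norm ?subr_ge0 //; lra.
Qed.

Lemma posD a b : pos a -> pos b -> pos (a + b).
Proof.
move=> [sa [t ta]] [sb [s bs]]; split; first exact: saD.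
exists (t + s); rewrite scD opprD addrACA; have := rnormD (sc t - a) (sc s - b); lra.
Qed.

Lemma posZ t a : 0 <= t -> pos a -> pos (of_real t *: a).
Proof.
move=> t0 [sa [s sa_]]; split; first exact: saZ.
exists (t * s); rewrite scM -scalerBr rnormZr ger0_norm //.
by rewrite ler_wpM2l.
Qed.

Lemma sub_norm_pos a t : sa A a -> rnorm a <= t -> pos (sc t - a).
Proof.
move=> sa at_; split; first exact: saB (sa_sc _ _) sa.
by exists t; rewrite opprB addrC subrK.
Qed.

Lemma pos_sc t : 0 <= t -> pos (sc t).
Proof.
move=> t0; rewrite -[sc t]subr0.
by apply: sub_norm_pos; rewrite ?rnorm0 //; exact: cstar0.
Qed.

(** With [|t - a| <= t], write [a + e = (t + e) (1 - (t - a) / (t + e))], where the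
    subtracted element has norm less than one. *)
Lemma pos_sqrt M a e : cstar_subalgebra M -> M 1c -> M a -> pos a -> 0 < e ->
  exists q, [/\ M q, sa A q & q *c q = a + sc e].
Proof.
move=> hM M1 Ma [sa_a [t ta]] e0.
have t0 : 0 <= t by exact: le_trans (rnorm_ge0 _) ta.
have te : 0 < t + e by lra.
have [|||s [Ms ss s2]] := @sqrt_one_sub M (of_real (t + e)^-1 *: (sc t - a)) hM M1.
- by apply: (subalgZ hM); apply: subalgB => //; exact: subalg_sc.
- by apply: saZ; exact: saB (sa_sc _ _) sa_a.
- rewrite rnormZr ger0_norm ?invr_ge0; last exact: ltW.
  rewrite mulrC ltr_pdivrMr // mul1r; lra.
pose q := Num.sqrt (t + e); have q2 : q * q = t + e.
  by rewrite -expr2 sqr_sqrtr // ltW.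
exists (of_real q *: s); split; [exact: subalgZ|exact: saZ|].
rewrite cmulZl cmulZr scalerA -of_realM q2 s2 scalerBr scalerA -of_realM.
by rewrite divff ?gt_eqF // scale1r -/(sc _) scD opprB addrC addrA subrK.
Qed.

(** The element [u = a + i b] satisfies [u* u = t], so [|u^2| <= |u|^2 <= t], and
    [a^2 - b^2] is the real part of [u^2]. *)
Lemma commuting_squares a b t : 0 <= t -> sa A a -> sa A b -> a *c b = b *c a ->
  a *c a + b *c b = sc t -> rnorm (a *c a - b *c b) <= t.
Proof.
move=> t0 sa_a sa_b ab abt; pose u := a + 'i *: b.
have us : cstar u = a - 'i *: b.
  by rewrite cstarD cstarZ conjCi sa_a sa_b scaleNr.
have i2 x : 'i *: ('i *: x) = - x by rewrite scalerA -expr2 sqrCi scaleN1r.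
have uu : cstar u *c u = sc t.
  rewrite us /u cmulBl !cmulDr !cmulZl !cmulZr i2 ab -abt opprD opprK addrA.
  by rewrite addrK.
have u2 : u *c u = (a *c a - b *c b) + 'i *: (a *c b + b *c a).
  rewrite /u cmulDl !cmulDr !cmulZl !cmulZr i2 scalerDr.
  by rewrite [RHS]addrACA; congr (_ + _); rewrite addrC.
have hu : hre (u *c u) = a *c a - b *c b.
  rewrite u2 hreD hrei him_sa; last first.
    by rewrite /sa /= cstarD !cstarM sa_a sa_b addrC.
  rewrite oppr0 addr0 hre_sa //.
  by apply: saB; exact: saM.
have un : rnorm u ^+ 2 <= t.
  by rewrite -rnorm_starM uu (le_trans (rnorm_sc _ _)) // ger0_norm.
by rewrite -hu (le_trans (rnorm_hre _)) // (le_trans (rnormM _ _)).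
Qed.

Lemma sa_in_comm_subalg a : sa A a -> exists N : comm_subalg A, comm_set N a.
Proof.
move=> sa_a; pose S := [set a; 1c].
have Sstar x : S x -> S (cstar x).
  by move=> [->|->]; rewrite ?sa_a ?cstar1; [left|right].
have Sab : abelian S.
  by move=> x y [->|->] [->|->]; rewrite ?cmul1l ?cmul1r.
have hM := @cstar_subalgebra_smallest _ _ S.
have M1 : smallest (@cstar_subalgebra R A) S 1c by move=> B [_ SB]; apply: SB; right.
exists (CommSubalg hM (abelian_smallest Sstar Sab) M1).
by move=> B [_ SB]; apply: SB; left.
Qed.

(** After scaling to [|a| < 1], take [q] with [q^2 = 1 - a^2]; then [a^2 - q^2] is
    [2 a^2 - 1], of norm at most one, so that [|1/2 - a^2| <= 1/2]. *)
Lemma pos_sq a : sa A a -> pos (a *c a).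
Proof.
move=> sa_a; pose c := (rnorm a + 1)^-1.
have a1 : 0 < rnorm a + 1 by rewrite ltr_pwDr // rnorm_ge0.
have c0 : 0 < c by rewrite invr_gt0.
pose b := of_real c *: a.
have sa_b : sa A b by exact: saZ.
have b1 : rnorm b < 1.
  by rewrite rnormZr gtr0_norm // mulrC ltr_pdivrMr // mul1r ltrDl.
have bb1 : rnorm (b *c b) < 1.
  by rewrite rnorm_saM //; have := rnorm_ge0 b; nra.
have [||||q [/= qb sq q2]] := @sqrt_one_sub
  [set x | forall y, y = b -> x *c y = y *c x] (b *c b) _ _ _ _ bb1.
- by apply: (@cstar_subalgebra_commutant _ _ [set b]) => _ ->; exact: sa_b.
- by move=> y _; rewrite cmul1l cmul1r.
- by move=> _ ->; rewrite cmulA.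
- exact: saM.
have : rnorm (b *c b - q *c q) <= 1.
  apply: commuting_squares => //; first by rewrite qb.
  by rewrite q2 addrC subrK sc1.
rewrite q2 opprB addrA => le1.
have pb : pos (b *c b).
  split; first exact: saM.
  exists 2^-1.
  have -> : sc 2^-1 - b *c b = of_real 2^-1 *: (1c - (b *c b + b *c b)).
    by rewrite scalerBr halve_double.
  rewrite rnormZr ger0_norm ?invr_ge0 // rnormC; lra.
have -> : a *c a = of_real (c ^- 2) *: (b *c b).
  rewrite /b cmulZl cmulZr !scalerA -!of_realM (_ : of_real _ = 1) ?scale1r //.
  by rewrite -of_real1; congr of_real; field; rewrite gt_eqF.
by apply: posZ => //; rewrite invr_ge0 exprn_ge0 // ltW.
Qed.

(** Up to a small scalar, [t - a] and [t + a] are squares of commuting elements, whose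
    sum is a scalar close to [2 t] and whose difference is [- 2 a]. *)
Lemma pos_norm_le a t : 0 <= t -> sa A a -> pos (sc t - a) -> pos (sc t + a) -> rnorm a <= t.
Proof.
move=> t0 sa_a pm pp; apply/ler_addgt0Pl => e e0.
have [[N hN cN N1] /= Na] := sa_in_comm_subalg sa_a.
have Nt := subalg_sc t hN N1.
have [q [Nq sq q2]] := pos_sqrt hN N1 (subalgB hN Nt Na) pm e0.
have [r [Nr sr r2]] := pos_sqrt hN N1 (subalgD hN Nt Na) pp e0.
have qr : q *c q + r *c r = sc (2 * (t + e)).
  rewrite q2 r2 addrACA (addrACA (sc t)) addNr addr0.
  by rewrite mulrDr !mulr_natl !mulr2n !scD.
have : rnorm (q *c q - r *c r) <= 2 * (t + e).
  apply: commuting_squares => //; last exact: cN.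
  by rewrite mulr_ge0 // addr_ge0 // ltW.
have -> : q *c q - r *c r = - (a + a).
  rewrite q2 r2 opprD addrACA subrr addr0 opprD addrACA subrr add0r.
  by rewrite -opprD.
rewrite rnormN -{3}(halve_double a) rnormZr ger0_norm ?invr_ge0 //; lra.
Qed.

Lemma star_sum_squares y :
  cstar y *c y + y *c cstar y =
  (hre y *c hre y + him y *c him y) + (hre y *c hre y + him y *c him y).
Proof.
move: (hre y) (him y) (sa_hre y) (sa_him y) (hre_him y) => a b sa_a sa_b yE.
have yE' : cstar y = a - 'i *: b.
  by rewrite yE cstarD cstarZ conjCi sa_a sa_b scaleNr.
have i2 x : 'i *: ('i *: x) = - x by rewrite scalerA -expr2 sqrCi scaleN1r.
rewrite yE' yE !cmulBl !cmulBr !cmulDl !cmulDr !cmulZl !cmulZr !i2 !opprD !opprK.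
rewrite (AC ((2*2)*(2*2)) (((1*4)*(5*8))*((2*7)*(6*3)))) /=.
by rewrite !subrr !addr0.
Qed.

(** With [T] a large scalar,
    [z = T - l - y* y] and [z' = T - l - y y*], the intertwining [y z = z' y] gives
    [y* y z^n = y* z'^n y], of norm at most [|y|^2 T^n]; so the powers of [z] grow at
    most linearly faster than those of [T], and [|z| <= T]. *)
Lemma pos_swap (l : R) y : 0 <= l ->
  pos (sc l + y *c cstar y) -> pos (sc l + cstar y *c y).
Proof.
move=> l0 [_ [t0 tP]]; split; first by apply: saD (sa_sc _ _) (sa_starM _).
pose T := Num.max (Num.max t0 l) 1.
have t0T : t0 <= T by rewrite /T !le_max lexx.
have lT : l <= T by rewrite /T !le_max lexx orbT.
have T1 : 1 <= T by rewrite /T le_max lexx orbT.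
have T0 : 0 < T by rewrite (lt_le_trans _ T1).
have vT := pos_mono tP t0T.
exists T; set u := cstar y *c y; set v := y *c cstar y in vT *.
rewrite opprD addrA -scB in vT.
set z := sc (T - l) - u; set z' := sc (T - l) - v in vT.
have yz : y *c z = z' *c y.
  by rewrite cmulBl cmulBr cmul_sc cmul_scr cmulA.
have sz : sa A z by apply: saB (sa_sc _ _) (sa_starM _).
pose S := rnorm y ^+ 2; have S0 : 0 <= S by exact: sqr_ge0.
have uz n : rnorm (u *c cpow z n) <= S * T ^+ n.
  rewrite /u -cmulA (cpow_intertwine _ yz).
  rewrite (le_trans (rnormM _ _)) // rnorm_cstar.
  have := rnormM (cpow z' n) y; have := rnorm_cpow z' n.
  have : rnorm z' ^+ n <= T ^+ n by apply: lerXn2r; rewrite ?nnegrE ?rnorm_ge0 // (ltW T0).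
  have := rnorm_ge0 y; rewrite /S; move: (rnorm y) => ny; nra.
have T0n n : 0 < T ^+ n by rewrite exprn_gt0.
have zn n : rnorm (cpow z n) <= (1 + n%:R * S) * T ^+ n.
  elim: n => [|n IH]; first by rewrite expr0 mul0r addr0 mul1r rnorm1_le1.
  have -> : cpow z n.+1 = of_real (T - l) *: cpow z n - u *c cpow z n.
    by rewrite cpowS cmulBl cmul_sc.
  rewrite (le_trans (rnormB _ _)) // rnormZr ger0_norm ?subr_ge0 //.
  have nS : 0 <= n%:R * S by rewrite mulr_ge0.
  rewrite exprS -natr1; have := uz n; have := T0n n; have := rnorm_ge0 (cpow z n).
  move: (rnorm _) (rnorm _) IH => q p; move: (T ^+ n) => Tn IH p0 Tn0 qle.
  have : (T - l) * p <= T * ((1 + n%:R * S) * Tn).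
    by apply: ler_pM; rewrite ?subr_ge0 ?gerBl.
  have : S * Tn <= T * (S * Tn) by rewrite ler_peMl // mulr_ge0 // ltW.
  lra.
rewrite opprD addrA -scB; apply: (@rnorm_le_growth _ _ z T (1 + S)) => // n.
apply: le_trans (zn n) _; rewrite ler_pM2r // -natr1.
have : 0 <= n%:R :> R by []; nra.
Qed.

(** It is twice the sum of the squares of the real and imaginary parts of [y]. *)
Lemma pos_star_sum y : pos (cstar y *c y + y *c cstar y).
Proof.
rewrite star_sum_squares.
have pp := posD (pos_sq (sa_hre y)) (pos_sq (sa_him y)).
exact: (posD pp pp).
Qed.

(** Put [u = b* b], [w = 1 - u] and [y = b w^n].  The element [1 - y* y = 1 - u w^(2n)]
    is positive, by induction on [n]: the increment is the square of
    [q u w^n] with [q^2 = 2 - u].  Adding [y* y + y y*] makes [1 + y y*] positive, and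
    [pos_swap] makes [1 + y* y] positive.  So [|u w^(2n)| <= 1] for all [n]; as
    [u = 1 - w], the powers of [w] grow at most linearly, whence [|w| <= 1], which is
    positivity of [u]. *)
Lemma pos_starM_contraction b : rnorm b <= 1 -> pos (cstar b *c b).
Proof.
move=> b1; set u := cstar b *c b.
have su : sa A u by exact: sa_starM.
have u1 : rnorm u <= 1.
  by rewrite /u rnorm_starM; have := rnorm_ge0 b; nra.
have [N Nu] := sa_in_comm_subalg su.
pose U : carrier N := cmk Nu.
have pU : pos (cval (1 - U)) by have := sub_norm_pos su u1; rewrite sc1.
have [q [Nq sq q2]] := pos_sqrt (comm_subalgP N) (comm_one N) (cvalP (1 - U)) pU ltr01.
pose Q : carrier N := cmk Nq.
have QQ : Q * Q = 1 - U + 1 by apply: cval_inj; rewrite cvalM q2 sc1.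
have sM (x y : carrier N) : sa A (cval x) -> sa A (cval y) -> sa A (cval (x * y)).
  by move=> sx sy; apply: saM => //; rewrite -!cvalM mulrC.
have s1 : sa A (cval (1 : carrier N)) by exact: sa1.
have sw : sa A (cval (1 - U)) by exact: saB.
have sX n : sa A (cval ((1 - U) ^+ n)).
  by elim: n => [|n IH]; rewrite ?expr0 // exprS; exact: sM.
have below n : pos (cval (1 - U * (1 - U) ^+ n * (1 - U) ^+ n)).
  elim: n => [|n IH]; first by rewrite expr0 !mulr1.
  set W := (1 - U) ^+ n in IH *.
  have -> : 1 - U * (1 - U) ^+ n.+1 * (1 - U) ^+ n.+1 =
      (1 - U * W * W) + (Q * U * W) * (Q * U * W).
    rewrite (_ : Q * U * W * _ = (Q * Q) * (U * U * W * W)); last by ring.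
    by rewrite QQ exprS -/W; ring.
  apply: posD => //; rewrite cvalM; apply: pos_sq.
  exact: sM (sM Q U sq su) (sX n).
have bound n : rnorm (cval (U * (1 - U) ^+ n * (1 - U) ^+ n)) <= 1.
  set W := (1 - U) ^+ n.
  pose y := b *c cval W.
  have yy : cstar y *c y = cval (U * W * W).
    by rewrite (mulrC U) /y cstarM (sX n) -cmulA (cmulA (cstar b)) !cvalM cmulA.
  have sV : sa A (cval (U * W * W)) by rewrite -yy; exact: sa_starM.
  have p1 : pos (sc 1 - cstar y *c y) by rewrite sc1 yy; exact: below.
  have := posD p1 (pos_star_sum y); rewrite addrA subrK => p2.
  have p3 := pos_swap ler01 p2.
  by apply: pos_norm_le => //; rewrite -yy.
have w2 : rnorm (cval (1 - U)) <= 2.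
  by have := rnormB (1c : A) u; have := rnorm1_le1 A; rewrite cvalB /=; lra.
have bound2 m : rnorm (cval (U * (1 - U) ^+ m)) <= 2.
  rewrite -(odd_double_half m) -addnn; case: (odd m).
    rewrite add1n exprS exprD.
    rewrite (_ : U * _ = (1 - U) * (U * (1 - U) ^+ m./2 * (1 - U) ^+ m./2)); last by ring.
    rewrite cvalM; have := bound (m./2); move: (cval (U * _ * _)) => v v1.
    rewrite (le_trans (rnormM _ _)) //.
    have := rnorm_ge0 v; have := rnorm_ge0 (cval (1 - U)); nra.
  rewrite add0n exprD mulrA; have := bound (m./2); lra.
split => //; exists 1; rewrite sc1.
apply: (@rnorm_le_growth _ _ _ 1 2) => // n; rewrite expr1n mulr1.
have -> : cpow (1c - u) n = cval ((1 - U) ^+ n) by rewrite cvalX.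
elim: n => [|n IH]; first by rewrite expr0 (le_trans (rnorm1_le1 A)) //; lra.
rewrite exprS mulrBl mul1r cvalB.
have := rnormB (cval ((1 - U) ^+ n)) (cval (U * (1 - U) ^+ n)).
have := bound2 n; rewrite -(natr1 n.+1); lra.
Qed.

(** Kaplansky's theorem, reduced to contractions by scaling. *)
Lemma pos_starM b : pos (cstar b *c b).
Proof.
have b1 : 0 < rnorm b + 1 by rewrite ltr_pwDr // rnorm_ge0.
set c := (rnorm b + 1)^-1; have c0 : 0 < c by rewrite invr_gt0.
have -> : cstar b *c b = of_real (c ^- 2) *: (cstar (of_real c *: b) *c (of_real c *: b)).
  rewrite cstarZ conj_of_real cmulZl cmulZr !scalerA -!of_realM (_ : of_real _ = 1) ?scale1r //.
  by rewrite -of_real1; congr of_real; field; rewrite gt_eqF.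
apply: posZ; first by rewrite invr_ge0 exprn_ge0 // ltW.
apply: pos_starM_contraction; rewrite rnormZr gtr0_norm //.
by rewrite mulrC ler_pdivrMr // mul1r lerDl.
Qed.

End Positivity.
(** * Minimal sublinear functionals *)

Section HahnBanach.
Variables (R : realType) (V : lmodType (cplx R)).
Implicit Types (x y a : V) (p : V -> R) (s t : R).

Definition sublinear p : Prop :=
  (forall x y, p (x + y) <= p x + p y) /\
  (forall t x, 0 < t -> p (of_real t *: x) <= t * p x).

Lemma sublinearZ p t x : sublinear p -> 0 <= t -> p (of_real t *: x) = t * p x.
Proof.
move=> [_ pZ]; rewrite le0r => /predU1P[->|t0].
  rewrite mul0r scale0r.
  have := pZ 2 0; have := pZ 2^-1 0; rewrite !scaler0 invr_gt0; lra.
apply/eqP; rewrite eq_le pZ //=.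
have := pZ t^-1 (of_real t *: x); rewrite invr_gt0 scalerA -of_realM => /(_ t0).
by rewrite mulVf ?gt_eqF // scale1r ler_pdivlMl.
Qed.

Lemma sublinear0 p : sublinear p -> p 0 = 0.
Proof. by move=> sp; have := sublinearZ 0 sp (lexx 0); rewrite scaler0 mul0r. Qed.

Lemma sublinear_opp p x : sublinear p -> - p (- x) <= p x.
Proof.
by move=> sp; have := sp.1 x (- x); rewrite subrr (sublinear0 sp); lra.
Qed.

(** Sublinear, below [p], and at most [- p a] at [- a]: a sublinear functional equal
    to all its pinnings is linear. *)
Definition pinned p a : V -> R :=
  fun x => inf [set p (x + of_real t *: a) - t * p a | t in [set t | 0 <= t]].

Lemma pinned_lbound p a x : sublinear p ->
  lbound [set p (x + of_real t *: a) - t * p a | t in [set t | 0 <= t]] (- p (- x)).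
Proof.
move=> sp _ [t t0 <-].
have := sp.1 (x + of_real t *: a) (- x).
rewrite addrAC subrr add0r (sublinearZ _ sp t0); lra.
Qed.

Lemma pinned_le p a x t : sublinear p -> 0 <= t ->
  pinned p a x <= p (x + of_real t *: a) - t * p a.
Proof.
move=> sp t0; apply: ge_inf; last by exists t.
by exists (- p (- x)); exact: pinned_lbound.
Qed.

Lemma pinned_lt p a x u : sublinear p -> pinned p a x < u ->
  exists2 t, 0 <= t & p (x + of_real t *: a) - t * p a < u.
Proof.
move=> sp /inf_lt[|_ [t t0 <-] tu]; last by exists t.
by exists (p (x + of_real 0 *: a) - 0 * p a); exists 0 => //=.
Qed.

Lemma sublinear_pinned p a : sublinear p -> sublinear (pinned p a).
Proof.
move=> sp; split=> [x y|t x t0]; apply/ler_addgt0Pl => e e0.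
  have [|s s0 se] := @pinned_lt p a x (pinned p a x + e / 2) sp.
    by rewrite ltrDl divr_gt0.
  have [|t t0 te] := @pinned_lt p a y (pinned p a y + e / 2) sp.
    by rewrite ltrDl divr_gt0.
  have := pinned_le a (x + y) sp (addr_ge0 s0 t0).
  rewrite of_realD scalerDl addrACA.
  have := sp.1 (x + of_real s *: a) (y + of_real t *: a); lra.
have [|s s0 se] := @pinned_lt p a x (pinned p a x + e / t) sp.
  by rewrite ltrDl divr_gt0.
have := pinned_le a (of_real t *: x) sp (mulr_ge0 (ltW t0) s0).
rewrite of_realM -scalerA -scalerDr (sublinearZ _ sp (ltW t0)) => le.
apply: le_trans le _.
rewrite -mulrA -mulrBr (_ : e + _ = t * (pinned p a x + e / t)).
  by apply: ler_wpM2l; exact: ltW.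
by field; rewrite gt_eqF.
Qed.

Lemma pinned_ler p a x : sublinear p -> pinned p a x <= p x.
Proof.
by move=> sp; have := pinned_le a x sp (lexx 0); rewrite scale0r addr0; lra.
Qed.

Lemma pinned_opp p a : sublinear p -> pinned p a (- a) <= - p a.
Proof.
move=> sp; have := pinned_le a (- a) sp ler01.
by rewrite scale1r addNr (sublinear0 sp); lra.
Qed.

(** Zorn's lemma: the pointwise infimum of a chain of sublinear functionals below [p]
    is finite, since each of them is at least [- p (- x)] at [x]. *)
Lemma minimal_sublinear p : sublinear p ->
  exists q, [/\ sublinear q, forall x, q x <= p x &
    forall r, sublinear r -> (forall x, r x <= q x) -> r = q].
Proof.
move=> sp; pose T := {q | sublinear q /\ forall x, q x <= p x}.
pose le (q r : T) := `[< forall x, sval r x <= sval q x >].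
have [|||F totF|[q [sq qp]] qmin] := @Zorn T le.
- by move=> q; apply/asboolP.
- move=> q r s /asboolP qr /asboolP rs; apply/asboolP => x.
  exact: le_trans (rs x) (qr x).
- move=> [q hq] [r hr] /asboolP qr /asboolP rq; apply: eq_exist => /=.
  by apply/funext => x; apply/eqP; rewrite eq_le qr rq.
- have [[q0 Fq0]|F0] := pselect (F !=set0); last first.
    exists (exist _ p (conj sp (fun x => lexx (p x)))) => s Fs.
    by exfalso; apply: F0; exists s.
  pose m x := inf [set sval r x | r in F].
  have lb x : lbound [set sval r x | r in F] (- p (- x)).
    move=> _ [[q [sq qp]] _ <-] /=.
    by rewrite (le_trans _ (sublinear_opp _ sq)) // lerN2.
  have m_le (q : T) x : F q -> m x <= sval q x.
    by move=> Fq; apply: ge_inf; [exists (- p (- x))|exists q].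
  have m_lt x u : m x < u -> exists2 r, F r & sval r x < u.
    move=> /inf_lt[|_ [q Fq <-] qu]; last by exists q.
    by exists (sval q0 x), q0.
  have sm : sublinear m.
    split=> [x y|t x t0]; apply/ler_addgt0Pl => e e0.
      have [|q Fq qe] := m_lt x (m x + e / 2); first by rewrite ltrDl divr_gt0.
      have [|r Fr re] := m_lt y (m y + e / 2); first by rewrite ltrDl divr_gt0.
      have [s Fs [sq sr]] : exists2 r', F r' &
          (forall x, sval r' x <= sval q x) /\ (forall x, sval r' x <= sval r x).
        by have [/asboolP H|/asboolP H] := totF _ _ Fq Fr; [exists r|exists q].
      have := m_le s (x + y) Fs; have := (svalP s).1.1 x y.
      have := sq x; have := sr y; lra.
    have [|q Fq qe] := m_lt x (m x + e / t); first by rewrite ltrDl divr_gt0.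
    have := m_le q (of_real t *: x) Fq; rewrite (sublinearZ _ (svalP q).1 (ltW t0)).
    move=> le1; apply: le_trans le1 _.
    rewrite (_ : e + _ = t * (m x + e / t)).
      by apply: ler_wpM2l; exact: ltW.
    by field; rewrite gt_eqF.
  have mp x : m x <= p x by exact: le_trans (m_le _ x Fq0) ((svalP q0).2 x).
  by exists (exist _ m (conj sm mp)) => q Fq; apply/asboolP => x; exact: m_le.
exists q; split=> // r sr rq.
have rp x : r x <= p x by exact: le_trans (rq x) (qp x).
have /qmin/(congr1 sval) // : le (exist _ q (conj sq qp)) (exist _ r (conj sr rp)).
exact/asboolP.
Qed.

(** The Hahn-Banach theorem: the functional is a minimal sublinear functional
    below [p] pinned at [a]; minimality makes it invariant under pinning, which is
    linearity. *)
Lemma hahn_banach p a : sublinear p -> exists F : V -> R,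
  [/\ forall x y, F (x + y) = F x + F y,
      forall t x, F (of_real t *: x) = t * F x,
      forall x, F x <= p x & F a = p a].
Proof.
move=> sp; have spa := sublinear_pinned a sp.
have [F [sF Fp Fmin]] := minimal_sublinear spa.
have FN x : F (- x) = - F x.
  have FE := Fmin _ (sublinear_pinned x sF) (fun y => pinned_ler _ _ sF).
  have := pinned_opp x sF; rewrite FE; have := sublinear_opp x sF; lra.
have Fle x : F x <= p x by exact: le_trans (Fp x) (pinned_ler _ _ sp).
exists F; split => //.
- move=> x y; have := sF.1 x y; have := sF.1 (- x) (- y).
  rewrite -opprD !FN; lra.
- move=> t x; have [t0|/ltW t0] := leP 0 t; first exact: sublinearZ.
  have := @sublinearZ F (- t) x sF; rewrite oppr_ge0 => /(_ t0).
  by rewrite of_realN scaleNr FN mulNr => /oppr_inj.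
- have := Fp (- a); rewrite FN; have := pinned_opp a sp; have := Fle a; lra.
Qed.

End HahnBanach.
(** * Positive functionals and states *)

Section States.
Variables (R : realType) (A : unitalCStarAlgType (cplx R)).
Implicit Types (x y z a b : A) (M : set A) (t s e : R) (k : cplx R).
Implicit Types (phi : A -> cplx R).

Local Notation sc := (sc A).
Local Notation im := (@complex.Im R).

Lemma cge0P (z : cplx R) : 0 <= z <-> im z = 0 /\ 0 <= re z.
Proof.
rewrite lecE; split=> [/andP[/eqP -> ?]|[-> ?]] //.
by rewrite eqxx.
Qed.

Section PositiveFunctional.
Variable phi : A -> cplx R.
Hypothesis phiL : scalar phi.

Lemma functionalD x y : phi (x + y) = phi x + phi y.
Proof. by have := phiL 1 x y; rewrite scale1r mul1r. Qed.
Lemma functional0 : phi 0 = 0.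
Proof. by apply: (addrI (phi 0)); rewrite -functionalD !addr0. Qed.
Lemma functionalZ k x : phi (k *: x) = k * phi x.
Proof. by have := phiL k x 0; rewrite functional0 !addr0. Qed.
Lemma functionalN x : phi (- x) = - phi x.
Proof. by rewrite -scaleN1r functionalZ mulN1r. Qed.
Lemma functionalB x y : phi (x - y) = phi x - phi y.
Proof. by rewrite functionalD functionalN. Qed.

Hypothesis phi_ge0 : forall a, 0 <= phi (cstar a *c a).

(** Polarization: the values at [(x + y)* (x + y)] and [(x + i y)* (x + i y)] are
    real. *)
Lemma functional_swap x y : phi (cstar y *c x) = (phi (cstar x *c y))^*.
Proof.
have im0 a : im (phi (cstar a *c a)) = 0 by have /cge0P[] := phi_ge0 a.
have := im0 (x + y); have := im0 (x + 'i *: y).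
rewrite !cstarD cstarZ conjCi !cmulDl !cmulDr !(cmulZl, cmulZr) scalerA mulNr.
rewrite -expr2 sqrCi opprK scale1r !functionalD !functionalZ.
have := im0 x; have := im0 y.
have -> : 'i = 'i%C :> cplx R by [].
move: (phi (cstar x *c x)) (phi (cstar x *c y)) (phi (cstar y *c x)).
move: (phi (cstar y *c y)) => [d d'] [a a'] [b b'] [c c'] /= d0 a0.
rewrite d0 a0 => H1 H2.
have -> : b = c by lra.
have -> : b' = - c' by lra.
by rewrite -[(_ +i* _)%C^*]/(_ +i* _)%C opprK.
Qed.

Lemma functional_cstar x : phi (cstar x) = (phi x)^*.
Proof. by have := functional_swap 1c x; rewrite cstar1 cmul1l cmul1r. Qed.

Lemma functional_sa a : sa A a -> phi a = of_real (re (phi a)).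
Proof. by move=> sa_a; apply: real_of_realE; rewrite -functional_cstar sa_a. Qed.

(** With [c = phi (x* y)], the value at the square of [x - t c^* y] is a real quadratic
    polynomial in [t] without negative values. *)
Lemma cauchy_schwarz x y :
  cabs (phi (cstar x *c y)) ^+ 2 <= re (phi (cstar x *c x)) * re (phi (cstar y *c y)).
Proof.
set c := phi (cstar x *c y); set p := re _; set q := re _.
have p0 : 0 <= p by exact: re_ge0.
have q0 : 0 <= q by exact: re_ge0.
set m := cabs c ^+ 2; have m0 : 0 <= m by exact: sqr_ge0.
have quad t : 0 <= p - 2 * t * m + t ^+ 2 * m * q.
  have := phi_ge0 (x + (of_real (- t) * c^*) *: y).
  rewrite cstarD cstarZ rmorphM /= conj_of_real conjCK.
  rewrite cmulDl !cmulDr !(cmulZl, cmulZr) !functionalD !functionalZ.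
  rewrite (functional_swap x y) -/c.
  set P := phi (cstar x *c x); set Q := phi (cstar y *c y).
  have cc : c * c^* = of_real m by exact: mul_conj_cabs.
  clearbody m.
  rewrite (_ : _ + _ + (_ + _) = P + of_real (- (2 * t) * m) + of_real (t ^+ 2 * m) * Q).
    move=> /re_ge0; rewrite !reD reZ re_of_real -/p -/q; lra.
  rewrite (_ : - (2 * t) * m = (- t) * m + (- t) * m); last by ring.
  rewrite (_ : t ^+ 2 * m = (- t) * (- t) * m); last by ring.
  by rewrite of_realD !of_realM -cc; ring.
move: q0; rewrite le0r => /predU1P[q0|q0].
  have := quad ((p + 1) / 2 ); rewrite q0 !mulr0 addr0.
  have := quad (m^-1 * (p + 1)).
  have [->//|mn0] := eqVneq m 0.
  rewrite q0 mulr0 addr0 -mulrA (mulrAC _ _ m) mulVf // mul1r; nra.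
have := quad q^-1.
rewrite (_ : p - _ + _ = p - m / q); last by field; rewrite gt_eqF.
by rewrite subr_ge0 ler_pdivrMr.
Qed.

(** Positive elements are squares up to an arbitrarily small scalar. *)
Lemma functional_pos a : pos a -> 0 <= re (phi a).
Proof.
move=> pa; have [N Na] := sa_in_comm_subalg pa.1.
have one0 : 0 <= re (phi 1c).
  by have := phi_ge0 1c; rewrite cstar1 cmul1l; exact: re_ge0.
apply/ler_addgt0Pl => e e0.
have e'0 : 0 < e / (re (phi 1c) + 1) by rewrite divr_gt0 // ltr_pwDr.
have [q [_ sq q2]] := pos_sqrt (comm_subalgP N) (comm_one N) Na pa e'0.
have := phi_ge0 q; rewrite sq q2 functionalD functionalZ => /re_ge0.
rewrite reD reZ => /le_trans; apply; rewrite addrC lerD2r.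
by rewrite mulrAC ler_pdivrMr ?ltr_pwDr // ler_pM2l // lerDl.
Qed.

Lemma functional_starM_le a :
  re (phi (cstar a *c a)) <= re (phi 1c) * rnorm a ^+ 2.
Proof.
have : pos (sc (rnorm a ^+ 2) - cstar a *c a).
  by apply: sub_norm_pos; [exact: sa_starM|rewrite rnorm_starM].
move=> /functional_pos; rewrite functionalB functionalZ reB reZ; lra.
Qed.

(** By the Cauchy-Schwarz inequality [|phi a|^2 <= phi (a* a)], and [phi (a* a)] is at
    most [|a|^2] because [|a|^2 - a* a] is positive. *)
Lemma functional_one_state : phi 1c = 1 -> state A phi.
Proof.
move=> one; have le a : cabs (phi a) <= rnorm a.
  have := cauchy_schwarz 1c a; rewrite cstar1 !cmul1l one -of_real1 re_of_real mul1r.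
  have := functional_starM_le a; rewrite one -of_real1 re_of_real mul1r => h1 h2.
  by rewrite -(@ler_pXn2r _ 2) ?nnegrE ?cabs_ge0 ?rnorm_ge0 // (le_trans h2).
split => //; apply/eqP; rewrite eq_le; apply/andP; split.
  apply: ge_ereal_sup => _ [a /= a1 <-]; rewrite lee_fin.
  exact: le_trans (le a) a1.
apply: ereal_sup_ubound; exists 1c => /=; first exact: rnorm1_le1.
by rewrite one cabs1.
Qed.
End PositiveFunctional.

Section OneState.
Variable phi : A -> cplx R.
Hypothesis phiS : state A phi.

Lemma state_scalar : scalar phi. Proof. by case: phiS. Qed.
Lemma state_ge0 a : 0 <= phi (cstar a *c a). Proof. by case: phiS. Qed.

Lemma state_le a : cabs (phi a) <= rnorm a.
Proof.
have le1 b : rnorm b <= 1 -> cabs (phi b) <= 1.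
  move=> b1; have [_ _ dn] := phiS.
  have : ((cabs (phi b))%:E <= dual_norm phi)%E by apply: ereal_sup_ubound; exists b.
  by rewrite dn lee_fin.
apply/ler_addgt0Pl => e e0.
have a0 : 0 < e + rnorm a by rewrite ltr_pwDl // rnorm_ge0.
have := le1 (of_real (e + rnorm a)^-1 *: a).
rewrite rnormZr functionalZ; last exact: state_scalar.
rewrite cabsM cabs_of_real gtr0_norm ?invr_gt0 // !ler_pdivrMl // mulr1.
by apply; rewrite lerDr ltW.
Qed.

(** The norm condition gives [1 <= phi 1]: by the Cauchy-Schwarz inequality,
    [|phi a|^2 <= phi 1 * phi (a* a) <= phi 1] for [|a| <= 1]. *)
Lemma state_one : phi 1c = 1.
Proof.
have sL := state_scalar; have s0 := state_ge0.
rewrite (functional_sa sL s0 (@sa1 _ _)); congr of_real.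
set u := re _; apply/eqP; rewrite eq_le.
have u1 : u <= 1.
  by rewrite (le_trans (ler_norm _)) // (le_trans (re_le_cabs _)) //
    (le_trans (state_le _)) // rnorm1_le1.
rewrite u1 /=.
have u0 : 0 <= u by have := s0 1c; rewrite cstar1 cmul1l => /re_ge0.
have le a : rnorm a <= 1 -> cabs (phi a) <= Num.sqrt u.
  move=> a1; have := cauchy_schwarz sL s0 1c a; rewrite cstar1 !cmul1l -/u => cs.
  have : re (phi (cstar a *c a)) <= 1.
    rewrite (le_trans (ler_norm _)) // (le_trans (re_le_cabs _)) //.
    rewrite (le_trans (state_le _)) // rnorm_starM.
    by have := rnorm_ge0 a; nra.
  move=> aa1; rewrite -(@ler_pXn2r _ 2) ?nnegrE ?cabs_ge0 ?sqrtr_ge0 // sqr_sqrtr //.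
  nra.
have [_ _ dn] := phiS.
have : (dual_norm phi <= (Num.sqrt u)%:E)%E.
  by apply: ge_ereal_sup => _ [a /= a1 <-]; rewrite lee_fin le.
by rewrite dn lee_fin -{1}sqrtr1 ler_psqrt ?nnegrE.
Qed.

End OneState.
End States.
(** * Existence of states *)

Section StateExistence.
Variables (R : realType) (A : unitalCStarAlgType (cplx R)).
Implicit Types (x y z a b h : A) (M : set A) (t s e : R).

Local Notation sc := (sc A).

Lemma trivial_algebra x : (1c : A) = 0 -> x = 0.
Proof. by move=> one0; rewrite -(cmul1l x) one0 cmul0l. Qed.

Lemma rnorm_one : (1c : A) <> 0 -> rnorm (1c : A) = 1.
Proof.
move=> nz; have := rnorm_saM (@sa1 _ A); rewrite cmul1l expr2.
have [n0|n0 e] := eqVneq (rnorm (1c : A)) 0; first by move/rnorm_eq0: n0.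
by apply: (mulfI n0); rewrite -e mulr1.
Qed.

(** The order-unit functional of the positive cone, on real parts. *)
Definition upper x : R := inf [set t | pos (sc t - hre x)].

Hypothesis nontrivial : (1c : A) <> 0.

Lemma pos_sc_ge0 t : pos (sc t) -> 0 <= t.
Proof.
move=> [_ [s]]; rewrite -scB rnormZr (rnorm_one nontrivial) mulr1.
by move=> /(le_trans (ler_norm _)); lra.
Qed.

Lemma upper_lbound x : lbound [set t | pos (sc t - hre x)] (- rnorm (hre x)).
Proof.
move=> t /= tx.
have nx : pos (sc (rnorm (hre x)) + hre x).
  rewrite -{2}(opprK (hre x)); apply: sub_norm_pos; last by rewrite rnormN.
  exact/saN/sa_hre.
have := posD tx nx; rewrite addrCA subrK -scD => /pos_sc_ge0; lra.
Qed.

Lemma upper_le x t : pos (sc t - hre x) -> upper x <= t.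
Proof.
by move=> tx; apply: ge_inf => //; exists (- rnorm (hre x)); exact: upper_lbound.
Qed.

Lemma upper_lt x s : upper x < s -> exists2 t, t < s & pos (sc t - hre x).
Proof.
move=> /inf_lt[|t tx ts]; last by exists t.
by exists (rnorm (hre x)); apply: sub_norm_pos => //; exact: sa_hre.
Qed.

Lemma sublinear_upper : sublinear upper.
Proof.
split=> [x y|t x t0]; apply/ler_addgt0Pl => e e0.
  have [|s se sx] := @upper_lt x (upper x + e / 2); first by rewrite ltrDl divr_gt0.
  have [|t te ty] := @upper_lt y (upper y + e / 2); first by rewrite ltrDl divr_gt0.
  have := posD sx ty; rewrite addrACA -scD -opprD -hreD => /upper_le; lra.
have [|s se sx] := @upper_lt x (upper x + e / t); first by rewrite ltrDl divr_gt0.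
have := posZ (ltW t0) sx; rewrite scalerBr -scM -hreZ => /upper_le le.
apply: le_trans le _; rewrite (_ : e + _ = t * (upper x + e / t)).
  by apply: ler_wpM2l; exact: ltW.
by field; rewrite gt_eqF.
Qed.

(** A linear functional below [upper] is nonnegative on the positive cone, which
    contains every [x* x], and takes the value one at the unit; its complexification is
    a state. *)
Lemma state_upper a : sa A a -> exists2 phi, state A phi & phi a = of_real (upper a).
Proof.
move=> sa_a; have [F [FD FZ Fp Fa]] := hahn_banach a sublinear_upper.
have FN x : F (- x) = - F x.
  by have := FZ (-1) x; rewrite of_realN of_real1 scaleN1r mulN1r.
have F_pos x : pos x -> 0 <= F x.
  move=> px; have := Fp (- x); rewrite FN.
  have : upper (- x) <= 0.
    by apply: upper_le; rewrite sc0 add0r hreN opprK hre_sa //; case: px.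
  lra.
pose phi x : cplx R := of_real (F (hre x)) + 'i * of_real (F (him x)).
have phi_sa x : sa A x -> phi x = of_real (F x).
  move=> sx; rewrite /phi hre_sa // him_sa // -(scale0r (0 : A)) -of_real0 FZ mul0r.
  by rewrite of_real0 mulr0 addr0.
have phiD x y : phi (x + y) = phi x + phi y.
  by rewrite /phi hreD himD !FD !of_realD mulrDr addrACA.
have phiZ t x : phi (of_real t *: x) = of_real t * phi x.
  by rewrite /phi hreZ himZ !FZ !of_realM mulrDr (mulrCA 'i).
have phii x : phi ('i *: x) = 'i * phi x.
  rewrite /phi hrei himi FN of_realN mulrDr mulrA -expr2 sqrCi mulN1r.
  by rewrite addrC.
exists phi; last by rewrite phi_sa // Fa.
apply: functional_one_state.
- move=> k x y; rewrite phiD; congr (_ + _).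
  have -> : k = of_real (re k) + 'i * of_real (complex.Im k) by exact: complexE.
  by rewrite scalerDl phiD phiZ -scalerA phii phiZ mulrDl mulrA.
- move=> x; rewrite phi_sa; last exact: sa_starM.
  by rewrite (of_real_le 0); apply/F_pos/pos_starM.
- rewrite phi_sa; last exact: sa1.
  rewrite -of_real1; congr of_real.
  have : upper 1c <= 1.
    by apply: upper_le; rewrite sc1 hre_sa ?subrr -?sc0; [exact: pos_sc|exact: sa1].
  have : upper (- 1c) <= - 1.
    apply: upper_le; rewrite scN sc1 hreN hre_sa ?subrr -?sc0; [exact: pos_sc|exact: sa1].
  by have := Fp 1c; have := Fp (- 1c); rewrite FN; lra.
Qed.

Lemma exists_state : exists phi, state A phi.
Proof. by have [phi ? _] := state_upper (@sa1 _ A); exists phi. Qed.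

(** One of the states that realize [upper a] and [upper (- a)] will do: if both values
    were less than [|a|], then [a] and [- a] would lie below a multiple [t < |a|] of the
    unit, and [pos_norm_le] would give [|a| <= t]. *)
Lemma state_norming a : sa A a ->
  exists2 phi, state A phi & rnorm a <= cabs (phi a).
Proof.
move=> sa_a.
have [phi1 s1 e1] := state_upper sa_a.
have [phi2 s2 e2] := state_upper (saN sa_a).
have [H1|H1] := leP (rnorm a) (upper a).
  by exists phi1 => //; rewrite e1 cabs_of_real (le_trans H1) // ler_norm.
have [H2|H2] := leP (rnorm a) (upper (- a)).
  exists phi2 => //; rewrite -cabsN -functionalN; last exact: state_scalar.
  by rewrite e2 cabs_of_real (le_trans H2) // ler_norm.
have [n0|n0] := eqVneq (rnorm a) 0.
  by exists phi1 => //; rewrite n0 cabs_ge0.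
exfalso; have [t1 lt1 p1] := upper_lt H1; have [t2 lt2 p2] := upper_lt H2.
pose t := Num.max 0 (Num.max t1 t2).
have t0 : 0 <= t by rewrite /t le_max lexx.
have tn : t < rnorm a by rewrite /t !gt_max lt_neqAle eq_sym n0 rnorm_ge0 lt1.
have : rnorm a <= t.
  apply: pos_norm_le => //.
    have : pos (sc (t - t1)) by apply: pos_sc; rewrite subr_ge0 /t !le_max lexx orbT.
    by move=> /posD/(_ p1); rewrite hre_sa // scB addrA subrK.
  have : pos (sc (t - t2)) by apply: pos_sc; rewrite subr_ge0 /t !le_max lexx !orbT.
  by move=> /posD/(_ p2); rewrite hreN opprK hre_sa // scB addrA subrK.
by rewrite leNgt tn.
Qed.

(** The state [phi] with [phi (- h) = upper (- h)] shows [upper (- h) < 0]. *)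
Lemma strictly_positive_bounded_below h : strictly_positive h ->
  exists2 s, 0 < s & pos (h - sc s).
Proof.
move=> [[b hb] hpos].
have sh : sa A h by rewrite hb; exact: sa_starM.
have [phi sphi phih] := state_upper (saN sh).
have : 0 < phi h by exact: hpos.
rewrite -(opprK h) functionalN; last exact: state_scalar.
rewrite phih -of_realN (of_real_lt 0) oppr_gt0 => /upper_lt[t t0 ht].
exists (- t); first by rewrite oppr_gt0.
by move: ht; rewrite hreN opprK (hre_sa sh) scN !opprK addrC.
Qed.

End StateExistence.

(** * Strictly positive elements *)

Section StrictlyPositive.
Variables (R : realType) (A : unitalCStarAlgType (cplx R)).
Implicit Types (x y z a b h : A) (M : set A) (t s e : R).

Local Notation sc := (sc A).

(** [M] contains [1 - k^n] whenever it contains [1 - k]; these tend to [1] when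
    [|k| < 1]. *)
Lemma subalg_one_of_contraction M k : cstar_subalgebra M -> M (1c - k) ->
  rnorm k < 1 -> M 1c.
Proof.
move=> hM Mk k1.
have Mn n : M (1c - cpow k n).
  elim: n => [|n IH]; first by rewrite subrr; exact: subalg0.
  rewrite (_ : _ - _ = (1c - k) + (1c - cpow k n) - (1c - k) *c (1c - cpow k n)).
    by apply: subalgB => //; [exact: subalgD|exact: subalgM].
  rewrite cmulBl cmul1l cmulBr cmul1r -cpowS opprB addrACA subrr addr0.
  by rewrite addrA subrK.
have /closed_rnorm := Defs.subalg_closed hM; apply => e e0.
have [N HN] := geometric_small 1 (rnorm_ge0 k) k1 e0.
exists (1c - cpow k N) => //; rewrite opprB addrC subrK.
by rewrite (le_lt_trans (rnorm_cpow _ _)) // -(mulr1 (_ ^+ _)) HN.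
Qed.

(** If [|T - (h - s)| <= T] with [s > 0], then [1 - h / (T + s)] has norm at most
    [T / (T + s)]. *)
Lemma strictly_positive_one M h : cstar_subalgebra M -> M h ->
  strictly_positive h -> M 1c.
Proof.
move=> hM Mh hpos.
have [one0|nz] := pselect ((1c : A) = 0); first by rewrite one0; exact: subalg0.
have [s s0 [_ [T hT]]] := strictly_positive_bounded_below nz hpos.
have T0 : 0 <= T by exact: le_trans (rnorm_ge0 _) hT.
have Ts : 0 < T + s by lra.
apply: (@subalg_one_of_contraction M (1c - of_real (T + s)^-1 *: h)) => //.
  by rewrite opprB addrC subrK; exact: subalgZ.
have -> : 1c - of_real (T + s)^-1 *: h = of_real (T + s)^-1 *: (sc T - (h - sc s)).
  by rewrite opprB addrA -scD scalerBr -scM mulVf ?sc1 ?gt_eqF.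
rewrite rnormZr gtr0_norm ?invr_gt0 // ltr_pdivrMl // mulr1; lra.
Qed.

Lemma cstar_generatedP h : strictly_positive h ->
  [/\ cstar_subalgebra (cstar_generated h), abelian (cstar_generated h) &
    cstar_generated h 1c].
Proof.
move=> hpos; have hM := @cstar_subalgebra_smallest _ _ [set h].
have sh : sa A h by case: hpos => -[b ->] _; exact: sa_starM.
split => //.
  apply: abelian_smallest => [x ->|x y -> -> //]; exact: sh.
by apply: (strictly_positive_one hM _ hpos) => B [_ SB]; exact: SB.
Qed.

Lemma strictly_positive_unit : strictly_positive (1c : A).
Proof.
split; first by exists 1c; rewrite cstar1 cmul1l.
by move=> phi sphi; rewrite (state_one sphi) ltr01.
Qed.

End StrictlyPositive.
(** * Characters from archimedean preorderings *)

Section Preorderings.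
Variables (R : realType) (B : comPzRingType) (rho : {rmorphism R -> B}).
Variable H : set B.
Hypothesis HD : forall x y, H x -> H y -> H (x + y).
Hypothesis HN : forall x, H x -> H (- x).
Hypothesis HM : forall x y, H x -> H y -> H (x * y).
Hypothesis Hrho : forall t, H (rho t).
Implicit Types (x y z : B) (Q : set B) (t s r e : R).

Record preordering Q : Prop := {
  preord_sub : Q `<=` H ;
  preord_sq : forall x, H x -> Q (x * x) ;
  preordD : forall x y, Q x -> Q y -> Q (x + y) ;
  preordM : forall x y, Q x -> Q y -> Q (x * y) ;
  preord_proper : ~ Q (-1) }.

Lemma maximal_preordering Q0 : preordering Q0 -> exists Q,
  [/\ preordering Q, Q0 `<=` Q &
    forall Q', preordering Q' -> Q `<=` Q' -> Q' `<=` Q].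
Proof.
move=> pQ0.
have [F FP totF|X [pX Xmax]] := @Zorn_bigcup B (fun X => preordering (Q0 `|` X)).
  have pU X : F X -> preordering (Q0 `|` X) by move=> FX; exact: FP.
  have common x y : (Q0 `|` \bigcup_(X in F) X) x -> (Q0 `|` \bigcup_(X in F) X) y ->
      exists Q, [/\ preordering Q, Q x, Q y & Q `<=` Q0 `|` \bigcup_(X in F) X].
    have sub X : F X -> Q0 `|` X `<=` Q0 `|` \bigcup_(X in F) X.
      by move=> FX; apply: setUS; exact: bigcup_sup.
    move=> [Qx|[X FX Xx]] [Qy|[Y FY Yy]].
    - by exists Q0; split => // z; left.
    - by exists (Q0 `|` Y); split; [exact: pU|left|right|exact: sub].
    - by exists (Q0 `|` X); split; [exact: pU|right|left|exact: sub].
    - have [XY|YX] := totF _ _ FX FY.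
        by exists (Q0 `|` Y); split; [exact: pU|right; exact: XY|right|exact: sub].
      by exists (Q0 `|` X); split; [exact: pU|right|right; exact: YX|exact: sub].
  split.
  - by move=> x /[dup] Ux /common /(_ Ux)[Q [pQ Qx _ _]]; exact: preord_sub Qx.
  - by move=> x Hx; left; exact: preord_sq.
  - by move=> x y Ux /(common _ _ Ux)[Q [pQ Qx Qy]]; apply; exact: preordD.
  - by move=> x y Ux /(common _ _ Ux)[Q [pQ Qx Qy]]; apply; exact: preordM.
  - by move=> /[dup] Ux /common /(_ Ux)[Q [pQ Qx _ _]]; exact: preord_proper Qx.
exists (Q0 `|` X); split; [exact: pX|exact: subsetUl|].
move=> Q' pQ' XQ'; have [//|nsub] := pselect (Q' `<=` Q0 `|` X).
exfalso; apply: (Xmax Q').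
  split; first by move=> x Xx; apply: XQ'; right.
  by move=> Q'X; apply: nsub => x /Q'X; right.
suff -> : Q0 `|` Q' = Q' by [].
by apply/setUidPr => x Qx; apply: XQ'; left.
Qed.

Lemma preord_scalar Q t : preordering Q -> 0 <= t -> Q (rho t).
Proof.
move=> pQ t0; rewrite -(sqr_sqrtr t0) rmorphXn expr2; exact: (preord_sq pQ).
Qed.

Lemma preord_scalar_ge0 Q t : preordering Q -> Q (rho t) -> 0 <= t.
Proof.
move=> pQ Qt; rewrite leNgt; apply/negP => t0; apply: (preord_proper pQ).
have := preordM pQ Qt (@preord_scalar Q (- t^-1) pQ _).
rewrite -rmorphM mulrN mulfV ?lt_eqF // rmorphN1; apply.
by rewrite oppr_ge0 invr_le0 ltW.
Qed.

Lemma adjoin_preordering Q x : preordering Q -> H x ->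
  ~ (exists p q, [/\ Q p, Q q & -1 = p + q * x]) ->
  preordering [set z | exists p q, [/\ Q p, Q q & z = p + q * x]].
Proof.
move=> pQ Hx proper.
have Q0 : Q 0 by have := preord_scalar pQ (lexx 0); rewrite rmorph0.
split => //.
- move=> _ [p [q [Qp Qq ->]]].
  by apply: HD; [|apply: HM => //]; exact: (preord_sub pQ).
- move=> y Hy; exists (y * y), 0; split => //; first exact: (preord_sq pQ).
  by rewrite mul0r addr0.
- move=> _ _ [p [q [Qp Qq ->]]] [p' [q' [Qp' Qq' ->]]].
  exists (p + p'), (q + q'); split; [exact: (preordD pQ)..|ring].
- move=> _ _ [p [q [Qp Qq ->]]] [p' [q' [Qp' Qq' ->]]].
  exists (p * p' + q * q' * (x * x)), (p * q' + q * p'); split; last ring.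
    apply: (preordD pQ); first exact: (preordM pQ).
    by apply: (preordM pQ); [exact: (preordM pQ)|exact: (preord_sq pQ)].
  by apply: (preordD pQ); exact: (preordM pQ).
Qed.

(** The Artin-Schreier argument: if neither [x] nor [- x] can be adjoined, the two
    representations of [-1] multiply to one that lies in [Q]. *)
Lemma maximal_preordering_total Q : preordering Q ->
  (forall Q', preordering Q' -> Q `<=` Q' -> Q' `<=` Q) ->
  forall x, H x -> Q x \/ Q (- x).
Proof.
move=> pQ Qmax x Hx.
have Q0 : Q 0 by have := preord_scalar pQ (lexx 0); rewrite rmorph0.
have Q1 : Q 1 by have := preord_scalar pQ ler01; rewrite rmorph1.
have adj y : H y -> ~ Q y -> exists p q, [/\ Q p, Q q & -1 = p + q * y].
  move=> Hy nQy; apply: contrapT => proper; apply: nQy.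
  apply: (Qmax _ (adjoin_preordering pQ Hy proper)).
    by move=> p Qp; exists p, 0; split => //; rewrite mul0r addr0.
  by exists 0, 1; split => //; rewrite mul1r add0r.
have [|nQx] := pselect (Q x); first by left.
have [|nQNx] := pselect (Q (- x)); first by right.
exfalso; have [p [q [Qp Qq e]]] := adj x Hx nQx.
have [p' [q' [Qp' Qq' e']]] := adj _ (HN Hx) nQNx.
(* q x = - (1 + p) and - q' x = - (1 + p'), hence - x^2 q q' = (1 + p) (1 + p') *)
apply: (preord_proper pQ).
have -> : -1 = p + p' + p * p' + q * q' * (x * x).
  have e1 : q * x = -1 - p by rewrite e; ring.
  have e2 : q' * x = 1 + p' by rewrite -[1]opprK e'; ring.
  rewrite (_ : q * q' * _ = (q * x) * (q' * x)); last by ring.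
  by rewrite e1 e2; ring.
apply: (preordD pQ); last first.
  by apply: (preordM pQ); [exact: (preordM pQ)|exact: (preord_sq pQ)].
by apply: (preordD pQ); [exact: (preordD pQ)|exact: (preordM pQ)].
Qed.

Section TotalPreordering.
Variable Q : set B.
Hypothesis pQ : preordering Q.
Hypothesis Qtot : forall x, H x -> Q x \/ Q (- x).
Hypothesis Qarch : forall x, H x -> exists t, Q (rho t - x).

(** The relation that makes [r] the standard part of [x] for the ordering [Q]. *)
Definition infclose x r : Prop :=
  forall e, 0 < e -> Q (x - rho r + rho e) /\ Q (rho r + rho e - x).

Lemma infclose_unique x r s : infclose x r -> infclose x s -> r = s.
Proof.
move=> xr xs; suff le a b : infclose x a -> infclose x b -> a <= b.
  by apply/eqP; rewrite eq_le !le.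
move=> xa xb; apply/ler_addgt0Pl => e e0.
have e20 : 0 < e / 2 by rewrite divr_gt0.
have := preordD pQ (xa _ e20).1 (xb _ e20).2.
rewrite (_ : _ + (_ - x) = rho (e / 2 + e / 2 + b - a)); last first.
  by rewrite rmorphB !rmorphD; ring.
move=> /(preord_scalar_ge0 pQ); rewrite -splitr; lra.
Qed.

Lemma infclose_rho t : infclose (rho t) t.
Proof.
move=> e e0; rewrite subrr add0r (addrC (rho t)) addrK.
by split; apply: (preord_scalar pQ); exact: ltW.
Qed.

Lemma infcloseD x y r s : infclose x r -> infclose y s -> infclose (x + y) (r + s).
Proof.
move=> xr ys e e0; have e20 : 0 < e / 2 by rewrite divr_gt0.
have [x1 x2] := xr _ e20; have [y1 y2] := ys _ e20.
have ee : rho e = rho (e / 2) + rho (e / 2) by rewrite -rmorphD -splitr.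
split; [move: (preordD pQ x1 y1)|move: (preordD pQ x2 y2)];
  by congr (Q _); rewrite ee !rmorphD; ring.
Qed.

Lemma infcloseN x r : infclose x r -> infclose (- x) (- r).
Proof.
move=> xr e /xr[x1 x2]; split; [move: x2|move: x1];
  by congr (Q _); rewrite rmorphN; ring.
Qed.

Lemma infcloseZ t x r : infclose x r -> infclose (rho t * x) (t * r).
Proof.
move=> xr; wlog t0 : t / 0 <= t => [W|].
  have [/W//|/ltW t0] := leP 0 t.
  have := infcloseN (W (- t) _); rewrite rmorphN !mulNr !opprK; apply.
  by rewrite oppr_ge0.
move=> e e0; have t1 : 0 < t + 1 by lra.
have d0 : 0 < e / (t + 1) by rewrite divr_gt0.
have [x1 x2] := xr _ d0.
have rest : Q (rho (e - t * (e / (t + 1)))).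
  apply: (preord_scalar pQ); rewrite subr_ge0 mulrCA ler_piMr ?(ltW e0) //.
  by rewrite ler_pdivrMr // mul1r lerDl.
have Qt := preord_scalar pQ t0.
split; [move: (preordD pQ (preordM pQ Qt x1) rest)|
  move: (preordD pQ (preordM pQ Qt x2) rest)];
  by congr (Q _); rewrite rmorphB !rmorphM; ring.
Qed.

(** The polarization
    [(x + d) (y + d) + (d - x) (d - y) = 2 (x y + d^2)] bounds [x y] below, and its
    analogue with [- y] bounds it above. *)
Lemma infcloseM0 x y : infclose x 0 -> infclose y 0 -> infclose (x * y) 0.
Proof.
move=> x0 y0 e e0; pose d := Num.min 1 e.
have d0 : 0 < d by rewrite lt_min ltr01.
have de : d * d <= e.
  have d1 : d <= 1 by rewrite ge_min lexx.
  have : d <= e by rewrite ge_min lexx orbT.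
  nra.
have [x1 x2] := x0 _ d0; have [y1 y2] := y0 _ d0.
rewrite rmorph0 !(subr0, add0r) in x1 x2 y1 y2 *.
have rest : Q (rho (e - d * d)) by apply: (preord_scalar pQ); rewrite subr_ge0.
have half : Q (rho 2^-1) by apply: (preord_scalar pQ); rewrite invr_ge0.
have h2 : rho 2^-1 * 2 = 1 by rewrite -(rmorph_nat rho) -rmorphM mulVf // rmorph1.
split.
  have := preordD pQ (preordM pQ half (preordD pQ (preordM pQ x1 y1) (preordM pQ x2 y2))) rest.
  congr (Q _); rewrite rmorphB rmorphM.
  rewrite (_ : (x + rho d) * _ + _ = 2 * (x * y + rho d * rho d)); last by ring.
  by rewrite mulrA h2; ring.
have := preordD pQ (preordM pQ half (preordD pQ (preordM pQ x1 y2) (preordM pQ x2 y1))) rest.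
congr (Q _); rewrite rmorphB rmorphM.
rewrite (_ : (x + rho d) * _ + _ = 2 * (rho d * rho d - x * y)); last by ring.
by rewrite mulrA h2; ring.
Qed.

Lemma infclose0 x r : infclose x r <-> infclose (x - rho r) 0.
Proof.
split=> [xr|x0].
  by have := infcloseD xr (infcloseN (infclose_rho r)); rewrite subrr.
by have := infcloseD x0 (infclose_rho r); rewrite subrK add0r.
Qed.

Lemma infcloseM x y r s : infclose x r -> infclose y s -> infclose (x * y) (r * s).
Proof.
move=> xr ys; apply/infclose0.
have -> : x * y - rho (r * s) =
    (x - rho r) * (y - rho s) + rho r * (y - rho s) + rho s * (x - rho r).
  by rewrite rmorphM; ring.
move/infclose0: xr => x0; move/infclose0: ys => y0.
have := infcloseD (infcloseD (infcloseM0 x0 y0) (infcloseZ r y0)) (infcloseZ s x0).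
by rewrite !mulr0 !addr0.
Qed.

(** The scalar is the supremum of the [t] with [x - t] in [Q]; the archimedean property
    makes the supremum exist, totality makes [x] infinitely close to it. *)
Lemma infclose_exists x : H x -> exists r, infclose x r.
Proof.
move=> Hx; pose S := [set t | Q (x - rho t)].
have [u Qu] := Qarch Hx; have [l Ql] := Qarch (HN Hx).
have ubS : ubound S u.
  move=> t /= Qt; have := preordD pQ Qu Qt.
  by rewrite addrA subrK -rmorphB => /(preord_scalar_ge0 pQ); rewrite subr_ge0.
have supS : has_sup S.
  split; last by exists u.
  by exists (- l); rewrite /S /= rmorphN opprK addrC -(opprK x).
exists (sup S) => e e0; split.
  have [t Qt lt] := sup_adherent e0 supS.
  have := preordD pQ Qt (@preord_scalar _ (t - (sup S - e)) pQ _).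
  rewrite (_ : _ + rho (t - _) = x - rho (sup S) + rho e); last by rewrite !rmorphB; ring.
  by apply; rewrite subr_ge0 ltW.
have [|Qn] := Qtot (HD Hx (HN (Hrho (sup S + e)))).
  move=> Se; have := ub_le_sup supS.2 Se; lra.
by rewrite -rmorphD -opprB.
Qed.

Lemma infclose_ge0 x r : Q x -> infclose x r -> 0 <= r.
Proof.
move=> Qx xr; apply/ler_addgt0Pl => e /xr[_ /(preordD pQ Qx)].
by rewrite addrC subrK -rmorphD => /(preord_scalar_ge0 pQ); rewrite addrC.
Qed.

Lemma total_preordering_character : exists chi : B -> R,
  [/\ forall x y, H x -> H y -> chi (x + y) = chi x + chi y,
      forall x y, H x -> H y -> chi (x * y) = chi x * chi y,
      forall t, chi (rho t) = t &
      forall x, Q x -> 0 <= chi x].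
Proof.
pose chi x := if pselect (H x) is left Hx then
  projT1 (cid (infclose_exists Hx)) else 0.
have chiP x : H x -> infclose x (chi x).
  by move=> Hx; rewrite /chi; case: pselect => // ?; case: cid.
exists chi; split.
- move=> x y Hx Hy; apply: (@infclose_unique (x + y)); first exact/chiP/HD.
  by apply: infcloseD; exact: chiP.
- move=> x y Hx Hy; apply: (@infclose_unique (x * y)); first exact/chiP/HM.
  by apply: infcloseM; exact: chiP.
- move=> t; apply: (@infclose_unique (rho t)); first exact/chiP.
  exact: infclose_rho.
- move=> x Qx; apply: (infclose_ge0 Qx); apply: chiP; exact: (preord_sub pQ).
Qed.

End TotalPreordering.

(** The Kadison-Dubois theorem, in the form: an archimedean preordering has a
    character that is nonnegative on it. *)
Lemma preordering_character Q0 : preordering Q0 ->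
  (forall x, H x -> exists t, Q0 (rho t - x)) ->
  exists chi : B -> R,
  [/\ forall x y, H x -> H y -> chi (x + y) = chi x + chi y,
      forall x y, H x -> H y -> chi (x * y) = chi x * chi y,
      forall t, chi (rho t) = t &
      forall x, Q0 x -> 0 <= chi x].
Proof.
move=> pQ0 arch; have [Q [pQ Q0Q Qmax]] := maximal_preordering pQ0.
have archQ x : H x -> exists t, Q (rho t - x).
  by move=> /arch[t Qt]; exists t; exact: Q0Q.
have [chi [chiD chiM chi_rho chi0]] :=
  total_preordering_character pQ (maximal_preordering_total pQ Qmax) archQ.
by exists chi; split => // x /Q0Q; exact: chi0.
Qed.

End Preorderings.
(** * Characters of abelian subalgebras *)

Section Gelfand.
Variables (R : realType) (A : unitalCStarAlgType (cplx R)) (N : comm_subalg A).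
Local Notation B := (carrier N).
Local Notation rho := (creal N).
Implicit Types (x y g : B).

Definition herm : set B := [set x | sa A (cval x)].

Lemma hermD x y : herm x -> herm y -> herm (x + y).
Proof. exact: saD. Qed.
Lemma hermN x : herm x -> herm (- x).
Proof. exact: saN. Qed.
Lemma hermM x y : herm x -> herm y -> herm (x * y).
Proof. by move=> hx hy; apply: saM => //; rewrite -!cvalM mulrC. Qed.
Lemma herm_creal t : herm (rho t).
Proof. exact: sa_sc. Qed.

Lemma cval_creal t : cval (rho t) = sc A t. Proof. by []. Qed.

(** The preordering generated by the squares and by [g]. *)
Inductive sos (g : B) : set B :=
| sos_sq x : herm x -> sos g (x * x)
| sos_gen x : herm x -> sos g (x * x * g)
| sosD x y : sos g x -> sos g y -> sos g (x + y).

Lemma sos_herm g x : herm g -> sos g x -> herm x.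
Proof.
move=> hg; elim=> [y hy|y hy|y z _ hy _ hz]; [exact: hermM| |exact: hermD].
by apply: hermM => //; exact: hermM.
Qed.

Lemma sosM g x y : herm g -> sos g x -> sos g y -> sos g (x * y).
Proof.
move=> hg; elim=> [u hu|u hu|u v _ IHu _ IHv].
- elim=> [v hv|v hv|v w _ IHv _ IHw].
  + by rewrite mulrACA; apply/sos_sq/hermM.
  + by rewrite mulrA mulrACA; apply/sos_gen/hermM.
  + by rewrite mulrDr; exact: sosD.
- elim=> [v hv|v hv|v w _ IHv _ IHw].
  + by rewrite mulrAC mulrACA; apply/sos_gen/hermM.
  + rewrite (_ : _ * _ = (u * v * g) * (u * v * g)); last by ring.
    by apply: sos_sq; apply: hermM => //; exact: hermM.
  + by rewrite mulrDr; exact: sosD.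
- by move=> sy; rewrite mulrDl; apply: sosD; [exact: IHu|exact: IHv].
Qed.

Lemma sos_archimedean g x : herm x -> exists t, sos g (rho t - x).
Proof.
move=> hx; exists (rnorm (cval x) + 1).
have px := sub_norm_pos hx (lexx (rnorm (cval x))).
have [q [Nq sq q2]] := pos_sqrt (comm_subalgP N) (comm_one N)
  (cvalP (rho (rnorm (cval x)) - x)) px ltr01.
have -> : rho (rnorm (cval x) + 1) - x = cmk Nq * cmk Nq.
  by apply: cval_inj; rewrite [RHS]q2 !cvalB !cval_creal scD addrAC.
exact: sos_sq.
Qed.

(** A state [phi] with [phi g = |g| = 1] satisfies [phi (g x) = phi x], by the
    Cauchy-Schwarz inequality; so it is nonnegative on the preordering generated by
    the squares and [g - 1/2], which is therefore proper. *)
Lemma character_ge_half g : herm g -> rnorm (cval g) <= 1 ->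
  (exists2 phi, state A phi & phi (cval g) = 1) ->
  exists chi : B -> R,
  [/\ forall x y, herm x -> herm y -> chi (x + y) = chi x + chi y,
      forall x y, herm x -> herm y -> chi (x * y) = chi x * chi y,
      forall t, chi (rho t) = t &
      2^-1 <= chi g].
Proof.
move=> hg g1 [phi sphi phig].
have [pL p0] := (state_scalar sphi, state_ge0 sphi).
have phi_g (z : A) : phi (cval g *c z) = phi z.
  suff : phi ((1c - cval g) *c z) = 0.
    rewrite cmulBl cmul1l functionalB // => /eqP; rewrite subr_eq0.
    by move/eqP.
  apply: cabs_eq0; apply/eqP; rewrite -sqrf_eq0 eq_le sqr_ge0 andbT.
  have s1g : sa A (1c - cval g) by apply: saB; [exact: sa1|].
  have := cauchy_schwarz pL p0 (1c - cval g) z; rewrite s1g => /le_trans; apply.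
  apply: mulr_le0_ge0; last exact/re_ge0/p0.
  have gg : re (phi (cval g *c cval g)) <= 1.
    rewrite (le_trans (ler_norm _)) // (le_trans (re_le_cabs _)) //.
    rewrite (le_trans (state_le sphi _)) // (rnorm_saM hg).
    by have := rnorm_ge0 (cval g); nra.
  rewrite cmulBl !cmulBr !cmul1l cmul1r !functionalB // phig (state_one sphi).
  by rewrite !reB -of_real1 !re_of_real; lra.
pose g' := g - rho 2^-1.
have hg' : herm g' by apply: hermD => //; apply: hermN; exact: herm_creal.
have sos_ge0 x : sos g' x -> 0 <= re (phi (cval x)).
  have sq y : herm y -> 0 <= re (phi (cval (y * y))).
    by move=> hy; apply: re_ge0; rewrite cvalM -{1}hy; exact: p0.
  elim=> [y hy|y hy|y z _ IHy _ IHz]; first exact: sq.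
    rewrite mulrC mulrBl cvalB (cvalM g) (cvalM (rho _)) cval_creal cmul_sc.
    rewrite functionalB // functionalZ // phi_g reB reZ.
    by have := sq y hy; lra.
  by rewrite cvalD functionalD // reD addr_ge0.
have pre : preordering herm (sos g').
  split.
  - by move=> x; exact: sos_herm.
  - by move=> x hx; exact: sos_sq.
  - by move=> x y; exact: sosD.
  - by move=> x y; exact: sosM.
  - move=> /sos_ge0; rewrite cvalN cval1 functionalN // (state_one sphi).
    by rewrite reN -of_real1 re_of_real; lra.
have [chi [chiD chiM chi_rho chi0]] := preordering_character hermD hermN hermM
  herm_creal pre (fun x hx => sos_archimedean g' hx).
exists chi; split => //.
have : 0 <= chi g'.
  apply: chi0; have := @sos_gen g' 1 (@sa1 _ _).
  by rewrite !mul1r.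
have -> : g' = g + rho (- 2^-1) by rewrite rmorphN.
by rewrite chiD // ?chi_rho; [lra|exact: herm_creal].
Qed.

Definition chre x : B := cmk (subalg_hre (comm_subalgP N) (cvalP x)).
Definition chim x : B := cmk (subalg_him (comm_subalgP N) (cvalP x)).

Lemma hre_him_unique (a b : A) : sa A a -> sa A b ->
  hre (a + 'i *: b) = a /\ him (a + 'i *: b) = b.
Proof.
move=> sa_a sa_b; rewrite hreD himD hrei himi (hre_sa sa_a) (him_sa sa_a).
by rewrite (hre_sa sa_b) (him_sa sa_b) oppr0 addr0 add0r.
Qed.

Lemma cmul_re_im (a b c d : A) : (a + 'i *: b) *c (c + 'i *: d) =
  (a *c c - b *c d) + 'i *: (a *c d + b *c c).
Proof.
rewrite cmulDl !cmulDr !(cmulZl, cmulZr) scalerA -expr2 sqrCi scaleN1r scalerDr.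
by rewrite [RHS]addrACA; congr (_ + _); rewrite addrC.
Qed.

Lemma complexified_character (chi : B -> R) :
  (forall x y, herm x -> herm y -> chi (x + y) = chi x + chi y) ->
  (forall x y, herm x -> herm y -> chi (x * y) = chi x * chi y) ->
  (forall t, chi (rho t) = t) ->
  spectrum (comm_set N) (fun x => of_real (chi (chre x)) + 'i * of_real (chi (chim x))).
Proof.
move=> chiD chiM chi_rho.
have hre_h x : herm (chre x) by exact: sa_hre.
have him_h x : herm (chim x) by exact: sa_him.
have chiN x : herm x -> chi (- x) = - chi x.
  move=> hx; rewrite -mulN1r -(rmorphN1 rho) chiM ?chi_rho ?mulN1r //.
  exact: herm_creal.
split.
- move=> k x y z zE; have {}zE : cval z = k *: cval x + cval y := zE.
  have [kr [ki kE]] : exists kr ki, k = of_real kr + 'i * of_real ki.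
    by exists (re k), (complex.Im k); exact: complexE.
  have zre : chre z = rho kr * chre x + - (rho ki * chim x) + chre y.
    apply: cval_inj; rewrite 2!cvalD cvalN !cvalM !cval_creal !cmkK !cmul_sc zE.
    rewrite hreD kE scalerDl hreD hreZ -scalerA hrei himZ.
    by [].
  have zim : chim z = rho kr * chim x + rho ki * chre x + chim y.
    apply: cval_inj; rewrite 2!cvalD !cvalM !cval_creal !cmkK !cmul_sc zE.
    rewrite himD kE scalerDl himD himZ -scalerA himi hreZ.
    by [].
  have hM u v : herm v -> herm (rho u * v).
    by move=> hv; apply: hermM => //; exact: herm_creal.
  rewrite zre zim !chiD ?chiN ?chiM ?chi_rho //; try exact: herm_creal;
    do ?[exact: hM|apply: hermD|apply: hermN]; rewrite //.
  rewrite kE !of_realD !of_realN !of_realM.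
  have := sqrCi (cplx R); move: ('i : cplx R) => i i2.
  rewrite [RHS](_ : _ = of_real kr * of_real (chi (chre x)) +
    i ^+ 2 * of_real ki * of_real (chi (chim x)) + of_real (chi (chre y))
    + i * (of_real kr * of_real (chi (chim x)) + of_real ki * of_real (chi (chre x))
           + of_real (chi (chim y)))); last by ring.
  by rewrite i2; ring.
- move=> x y z zE; have {}zE : cval z = cval x *c cval y := zE.
  have zE' : cval z = (cval (chre x * chre y - chim x * chim y)) +
      'i *: cval (chre x * chim y + chim x * chre y).
    rewrite [LHS]zE [X in X *c _](hre_him (cval x)) [X in _ *c X](hre_him (cval y)).
    exact: cmul_re_im.
  have hA : herm (chre x * chre y - chim x * chim y).
    by apply: hermD; [|apply: hermN]; exact: hermM.
  have hB : herm (chre x * chim y + chim x * chre y).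
    by apply: hermD; exact: hermM.
  have [zr zi] := hre_him_unique hA hB.
  have zre : chre z = chre x * chre y - chim x * chim y.
    by apply: cval_inj; rewrite cmkK zE' zr.
  have zim : chim z = chre x * chim y + chim x * chre y.
    by apply: cval_inj; rewrite cmkK zE' zi.
  rewrite zre zim !chiD ?chiN ?chiM //; try exact: hermM; last exact/hermN/hermM.
  rewrite !of_realD of_realN !of_realM.
  have := sqrCi (cplx R); move: ('i : cplx R) => i i2.
  rewrite [RHS](_ : _ = of_real (chi (chre x)) * of_real (chi (chre y)) +
    i ^+ 2 * of_real (chi (chim x)) * of_real (chi (chim y)) +
    i * (of_real (chi (chre x)) * of_real (chi (chim y)) +
         of_real (chi (chim x)) * of_real (chi (chre y)))); last by ring.
  by rewrite i2; ring.
- exists (1 : B); have -> : chre 1 = rho 1.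
    by apply: cval_inj; rewrite cmkK cval1 cval_creal sc1 hre_sa //; exact: sa1.
  have -> : chim 1 = rho 0.
    by apply: cval_inj; rewrite cmkK cval1 cval_creal sc0 him_sa //; exact: sa1.
  by rewrite !chi_rho of_real0 mulr0 addr0 oner_neq0.
Qed.

End Gelfand.
(** * Pointwise convergence of complex functions *)

Section PointwiseTopology.
Variables (R : realType) (I : eqType).
Implicit Types (f g : {ptws I -> cplx R}) (s : seq I) (e : R).

Local Notation C := (cplx R).

Definition ptws_ball f s e : set {ptws I -> C} :=
  [set g | forall x, x \in s -> cabs (f x - g x) < e].

Lemma nbhs_cabsP (z : C) (P : set C) :
  nbhs z P <-> exists2 e : R, 0 < e & forall w, cabs (z - w) < e -> P w.
Proof. exact: (@nbhs_rnormP R (C^o) z P). Qed.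

Lemma nbhs_ptws_ball f s e : 0 < e -> nbhs f (ptws_ball f s e).
Proof.
have FF : Filter (nbhs f) by exact: nbhs_filter.
move=> e0; elim: s => [|x s IH].
  by apply: (@filterS _ (nbhs f) FF setT) => [g _ x //|]; exact: (@filterT _ _ FF).
have near : nbhs f [set g | cabs (f x - g x) < e].
  apply: (@proj_continuous I (fun=> C) x f [set z | cabs (f x - z) < e]).
  by apply/nbhs_cabsP; exists e.
have -> : ptws_ball f (x :: s) e = [set g | cabs (f x - g x) < e] `&` ptws_ball f s e.
  apply/seteqP; split=> g => [fg|[fgx fgs] y]; last first.
    by rewrite inE => /predU1P[->//|]; exact: (fgs y).
  split=> [|y ys]; apply: fg; first exact: mem_head.
  by rewrite inE ys orbT.
exact: (@filterI _ (nbhs f) FF _ _ near IH).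
Qed.

Lemma nbhs_ptwsP f (V : set {ptws I -> C}) :
  nbhs f V <-> exists s e, 0 < e /\ ptws_ball f s e `<=` V.
Proof.
split; last first.
  move=> [s [e [e0 sV]]].
  have FF : Filter (nbhs f) by exact: nbhs_filter.
  exact: (@filterS _ (nbhs f) FF _ _ sV (nbhs_ptws_ball f s e0)).
pose F : set_system {ptws I -> C} :=
  filter_from [set se : seq I * R | 0 < se.2] (fun se => ptws_ball f se.1 se.2).
have FF : Filter F.
  apply: filter_from_filter; first by exists ([::], 1) => /=.
  move=> [s e] [t d] /= e0 d0; exists (s ++ t, Num.min e d) => /=.
    by rewrite lt_min e0.
  move=> g fg; split=> x xs; have := fg x; rewrite mem_cat xs ?orbT => /(_ isT);
    by rewrite lt_min => /andP[].
have : F --> f.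
  apply/cvg_sup => i U [V0 [[W oW <-] WfN WU]].
  have /nbhs_cabsP[e e0 fW] : nbhs (f i) W by exact: open_nbhs_nbhs.
  exists ([:: i], e) => //= g fg; apply: WU; apply: fW; apply: fg.
  by rewrite inE.
by move=> /(_ V) + fV => /(_ fV)[[s e] /= e0 sV]; exists s, e.
Qed.

Lemma closed_ptws (S : set {ptws I -> C}) :
  (forall f, (forall s e, 0 < e -> exists2 g, S g & ptws_ball f s e g) -> S f) ->
  closed S.
Proof.
move=> H f clf; apply: H => s e e0.
by have [g [Sg fg]] := clf _ (nbhs_ptws_ball f s e0); exists g.
Qed.

Lemma compact_disk (r : R) : compact [set z : C | cabs z <= r].
Proof.
pose f (p : R * R) : C := of_real p.1 + 'i%C * of_real p.2.
have cf : continuous f.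
  move=> p; apply/cvg_ballP => e e0.
  have er : of_real (re e) = e by rewrite of_real_re // ltW.
  have re0 : 0 < re e / 2 by rewrite divr_gt0 // -of_real_lt er.
  exists (ball p.1 (re e / 2), ball p.2 (re e / 2)) => /=.
    by split; exact: nbhsx_ballx.
  move=> q [/= h1 h2]; rewrite -ball_normE /= in h1; rewrite -ball_normE /= in h2.
  rewrite -ball_normE /= norm_cabs -er of_real_lt.
  rewrite /f opprD addrACA -mulrBr -!of_realB.
  rewrite (le_lt_trans (cabs_le_reim _)) //.
  have -> : re (of_real (p.1 - q.1) + 'i%C * of_real (p.2 - q.2)) = p.1 - q.1.
    by rewrite /re /=; ring.
  have -> : complex.Im (of_real (p.1 - q.1) + 'i%C * of_real (p.2 - q.2)) = p.2 - q.2.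
    by rewrite /=; ring.
  lra.
have cS := compact_setX (@segment_compact R (- r) r) (@segment_compact R (- r) r).
apply: subclosed_compact (continuous_compact (continuous_subspaceT cf) cS) _.
  apply/(@closed_rnorm R C^o) => z approx; apply/ler_addgt0Pl => e /approx[w wr zw].
  have := cabsD (z - w) w; rewrite subrK => /le_trans; apply.
  by rewrite lerD // ltW.
move=> z /= zr; exists (re z, complex.Im z); last by rewrite /f /= -complexE.
by split => /=; rewrite in_itv /= -ler_norml (le_trans _ zr) ?re_le_cabs ?im_le_cabs.
Qed.

Lemma compact_ptws (S : set {ptws I -> C}) (r : I -> R) :
  closed S -> (forall f x, S f -> cabs (f x) <= r x) -> compact S.
Proof.
move=> clS Sr.
have cP := @tychonoff I (fun=> C) (fun x => [set z : C | cabs z <= r x])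
  (fun x => @compact_disk (r x)).
by apply: subclosed_compact clS cP _ => f Sf x; exact: Sr.
Qed.

End PointwiseTopology.

(** * The Gel'fand spectrum and its indicator *)

Section Spectrum.
Variables (R : realType) (A : unitalCStarAlgType (cplx R)) (N : comm_subalg A).
Local Notation B := (carrier N).
Local Notation rho := (creal N).
Implicit Types (x y g : B) (chi : B -> cplx R).

Section OneCharacter.
Variable chi : B -> cplx R.
Hypothesis chiS : spectrum (comm_set N) chi.

Lemma characterZ (k : cplx R) x z : cval z = k *: cval x -> chi z = k * chi x.
Proof.
have [lin _ _] := chiS.
have chi0 : chi 0 = 0.
  have e0 : set_val (0 : B) = 1 *: set_val (0 : B) + set_val (0 : B).
    by rewrite -[set_val (0 : B)]/(0 : A) scale1r addr0.
  have /eqP := lin 1 (0 : B) (0 : B) (0 : B) e0.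
  by rewrite mul1r -subr_eq subrr eq_sym => /eqP.
move=> zE; rewrite (lin k x (0 : B) z) ?chi0 ?addr0 //.
Qed.

Lemma characterD x y : chi (x + y) = chi x + chi y.
Proof.
by have [lin _ _] := chiS; rewrite (lin 1 x y) ?mul1r // scale1r.
Qed.

Lemma characterM x y : chi (x * y) = chi x * chi y.
Proof. by have [_ mul _] := chiS; rewrite (mul x y). Qed.

Lemma character1 : chi 1 = 1.
Proof.
have [_ _ [m m0]] := chiS.
by apply: (mulIf m0); rewrite -characterM !mul1r.
Qed.

(** If [|chi x| > |x|], then [y = x / chi x] has norm less than [1], so that
    [z = 1 + y z] has a solution in the algebra; but [chi y = 1]. *)
Lemma character_le x : cabs (chi x) <= rnorm (cval x).
Proof.
rewrite leNgt; apply/negP => lt.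
have c0 : 0 < cabs (chi x) by exact: le_lt_trans (rnorm_ge0 _) lt.
have cx0 : chi x != 0 by apply: contraTneq c0 => ->; rewrite cabs0 ltxx.
pose a := (chi x)^-1 *: cval x.
have Na : comm_set N a by apply: (subalgZ (comm_subalgP N)); exact: cvalP.
have a1 : rnorm a < 1.
  have cV : cabs (chi x)^-1 = (cabs (chi x))^-1.
    have := cabsM (chi x)^-1 (chi x); rewrite mulVf // cabs1 => e.
    by rewrite -[RHS]mul1r e mulfK // gt_eqF.
  by rewrite rnormZ cV ltr_pdivrMl // mulr1.
have [z Nz fz] : exists2 z, comm_set N z & 1c + a *c z = z.
  apply: (@contraction_fixpoint _ _ (comm_set N) (fun z => 1c + a *c z) (rnorm a) 1c).
  - exact: (Defs.subalg_closed (comm_subalgP N)).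
  - exact: comm_one.
  - exact: rnorm_ge0.
  - exact: a1.
  - move=> z Nz; apply: (subalgD (comm_subalgP N)); first exact: comm_one.
    exact: subalgM (comm_subalgP N) _ _ Na Nz.
  - by move=> z w _ _; rewrite opprD addrACA subrr add0r -cmulBr rnormM.
have : chi (cmk Nz) = chi (1 + cmk Na * cmk Nz).
  by congr chi; apply: cval_inj; rewrite -[LHS]fz.
rewrite characterD characterM character1 (@characterZ (chi x)^-1 x (cmk Na)) //.
rewrite mulVf // mul1r => /eqP; rewrite -subr_eq subrr eq_sym oner_eq0 //.
Qed.

End OneCharacter.

(** If [x] is not zero, a state takes the value one at [g = x* x / |x|^2], which has
    norm one; so some character is at least [1/2] at [g], hence not zero at [x]. *)
Lemma gelfand_injective x :
  (forall chi, spectrum (comm_set N) chi -> chi x = 0) -> x = 0.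
Proof.
move=> chi_x; apply: contrapT => x0.
have vx0 : cval x <> 0 by move=> vx0; apply: x0; exact: cval_inj.
have nz : (1c : A) <> 0 by move=> /(trivial_algebra (cval x)).
have nx : 0 < rnorm (cval x).
  rewrite lt_neqAle rnorm_ge0 andbT eq_sym; apply/eqP => /rnorm_eq0; exact: vx0.
have Nsx := subalg_star (comm_subalgP N) (cvalP x).
pose c := (rnorm (cval x) ^+ 2)^-1; have c0 : 0 < c by rewrite invr_gt0 exprn_gt0.
pose g : B := rho c * (cmk Nsx * x).
have gE : cval g = of_real c *: (cstar (cval x) *c cval x).
  by rewrite !cvalM cmkK cval_creal cmul_sc.
have hg : herm g by rewrite /herm /= gE; apply/saZ/sa_starM.
have g1 : rnorm (cval g) = 1.
  rewrite gE rnormZr rnorm_starM gtr0_norm // mulVf // gt_eqF //.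
  by rewrite exprn_gt0.
have [phi sphi phig] := state_norming nz hg.
have phi1 : phi (cval g) = 1.
  have pg0 : 0 <= phi (cval g).
    rewrite gE functionalZ; last exact: state_scalar.
    by apply: mulr_ge0; [rewrite (of_real_le 0) ltW|exact: state_ge0].
  rewrite -(of_real_re pg0) -of_real1; congr of_real.
  have : cabs (phi (cval g)) = re (phi (cval g)).
    by rewrite /cabs ger0_norm.
  have := state_le sphi (cval g); rewrite g1 in phig *; lra.
have [chi [chiD chiM chi_rho chig]] := character_ge_half hg (eq_ind_r (fun u => u <= 1) (lexx 1) g1)
  (ex_intro2 _ _ phi sphi phi1).
have chiS := complexified_character chiD chiM chi_rho.
have : chi g = 0.
  have gre : chre g = g by apply: cval_inj; rewrite cmkK hre_sa.
  have gim : chim g = rho 0.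
    by apply: cval_inj; rewrite cmkK cval_creal sc0 him_sa.
  have /= := characterM chiS (rho c * cmk Nsx) x.
  rewrite (chi_x _ chiS) mulr0 -mulrA -/g gre gim chi_rho of_real0 mulr0 addr0.
  by move/(@of_real_inj _ _ 0).
move: chig; lra.
Qed.

Lemma cabs_small_eq (z w : cplx R) (K : R) :
  (forall e, 0 < e -> cabs (z - w) <= K * e) -> z = w.
Proof.
move=> small; apply/eqP; rewrite -subr_eq0; apply/eqP/cabs_eq0/eqP.
rewrite eq_le cabs_ge0 andbT; apply/ler_addgt0Pl => e e0; rewrite addr0.
have K1 : 0 < `|K| + 1 by rewrite ltr_pwDr.
apply: le_trans (small (e / (`|K| + 1)) _) _; first by rewrite divr_gt0.
rewrite mulrCA ler_piMr ?(ltW e0) // ler_pdivrMr // mul1r.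
by rewrite (le_trans (ler_norm _)) // lerDl.
Qed.

Lemma closed_spectrum :
  closed (spectrum (comm_set N) : set {ptws comm_set N -> cplx R}).
Proof.
apply: closed_ptws => f approx.
split.
- move=> k x y z zE; apply: (@cabs_small_eq _ _ (2 + cabs k)) => e e0.
  have [g [lin _ _] fg] := approx [:: x; y; z] e e0.
  have gz := lin _ _ _ _ zE.
  have -> : f z - (k * f x + f y) = (f z - g z) + (k * (g x - f x) + (g y - f y)).
    by rewrite gz; ring.
  apply: le_trans (cabsD _ _) _.
  have := cabsD (k * (g x - f x)) (g y - f y); rewrite cabsM.
  rewrite (cabsC (g x)) (cabsC (g y)).
  have fx : cabs (f x - g x) < e by apply: fg; rewrite !inE eqxx.
  have fy : cabs (f y - g y) < e by apply: fg; rewrite !inE eqxx orbT.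
  have fz : cabs (f z - g z) < e by apply: fg; rewrite !inE eqxx !orbT.
  have := cabs_ge0 k; nra.
- move=> x y z zE.
  apply: (@cabs_small_eq _ _ (1 + cabs (f x) + rnorm (cval y))) => e e0.
  have [g gS fg] := approx [:: x; y; z] e e0; have [_ mul _] := gS.
  have gz := mul _ _ _ zE.
  have -> : f z - f x * f y = (f z - g z) + (f x * (g y - f y) + (g x - f x) * g y).
    by rewrite gz; ring.
  apply: le_trans (cabsD _ _) _.
  have := cabsD (f x * (g y - f y)) ((g x - f x) * g y); rewrite !cabsM.
  rewrite (cabsC (g x)) (cabsC (g y)).
  have fx : cabs (f x - g x) < e by apply: fg; rewrite !inE eqxx.
  have fy : cabs (f y - g y) < e by apply: fg; rewrite !inE eqxx orbT.
  have fz : cabs (f z - g z) < e by apply: fg; rewrite !inE eqxx !orbT.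
  have := character_le gS y; have := cabs_ge0 (f x); have := cabs_ge0 (f x - g x).
  have := cabs_ge0 (g y); have := cabs_ge0 (f y - g y).
  move: (cabs _) (cabs _) (cabs _) (cabs _) (rnorm _) fx fy fz => *; nra.
- exists (1 : B); suff -> : f (1 : B) = 1 by exact: oner_neq0.
  apply: (@cabs_small_eq _ _ 1) => e e0.
  have [g gS fg] := approx [:: (1 : B)] e e0.
  rewrite -(character1 gS) mul1r ltW //; apply: fg; exact: mem_head.
Qed.

Lemma compact_spectrumT : compact_spectrum (comm_set N) (spectrum (comm_set N)).
Proof.
split => //.
apply: (@compact_ptws _ _ _ (fun x : comm_set N => rnorm (cval x)) closed_spectrum).
by move=> chi x chiS; exact: character_le.
Qed.

(** Elements of the algebra whose Gel'fand transform is at least one dominate the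
    unit, and by injectivity of the transform the unit is the only one lying below
    the unit; so the net that defines the indicator of the whole spectrum is
    eventually constant. *)
Lemma indicatorT (psi : A -> cplx R) : indicator (spectrum (comm_set N)) psi = psi 1c.
Proof.
pose K : set (B -> cplx R) := spectrum (comm_set N).
pose below (g : B) : set B :=
  [set f | above K f /\ forall chi, spectrum (comm_set N) chi -> chi f <= chi g].
have aboveE f : above K f <-> forall chi, K chi -> 1 <= chi f.
  split=> H chi chiS; have := H chi chiS; rewrite indicE mem_set //.
have above1 : above K (1 : B).
  by apply/aboveE => chi chiS; rewrite (character1 chiS).
have below1 f : below 1 f -> f = 1.
  move=> [/aboveE fK fle]; apply/eqP; rewrite -subr_eq0; apply/eqP.
  apply: gelfand_injective => chi chiS.
  have f1 : chi f = 1.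
    by apply/eqP; rewrite eq_le fK // andbT -(character1 chiS) fle.
  rewrite (characterD chiS) f1 (characterZ chiS (k := -1) (x := 1)) ?scaleN1r //.
  by rewrite (character1 chiS) mulr1 subrr.
have one_below f : above K f -> below f 1.
  move=> fK; split => // chi chiS; rewrite (character1 chiS).
  by move/aboveE: fK; apply.
have FF : ProperFilter (filter_from (above K) below).
  apply: filter_from_proper; last by move=> f fK; exists (1 : B); exact: one_below.
  apply: filter_from_filter; first by exists (1 : B).
  move=> f g fK gK; exists (1 : B) => // h /below1 ->.
  by split; exact: one_below.
apply: (@cvg_lim _ (@norm_hausdorff _ (cplx R)^o) _ _ (fmap_proper_filter _ FF)).
move=> U /nbhs_singleton psiU; exists (1 : B) => // f /below1 -> //.
Qed.

Lemma arens_indicatorT (phi : A -> cplx R) a :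
  let chiK := indicator (spectrum (comm_set N)) in
  arens (arens chiK (to_bidual a)) chiK phi = phi a.
Proof. by rewrite /= /arens indicatorT /to_bidual indicatorT cmul1l cmul1r. Qed.

End Spectrum.
(** * Topographies and the weak* compact state space *)

Section Topographies.
Variables (R : realType) (A : unitalCStarAlgType (cplx R)).
Implicit Types (M : set A).

(** An approximate identity, applied to the unit, converges to the unit inside [M]. *)
Lemma topographicP M : cstar_subalgebra M -> abelian M -> (topographic M <-> M 1c).
Proof.
move=> hM abM; split=> [[_ _ [I [le [e [_ [lexx_ _ _] [Me _ _ _] eA]]]]]|M1].
  have /closed_rnorm := Defs.subalg_closed hM; apply => d d0.
  have [cv _] := eA 1c.
  have : nbhs (1c : A) [set y | rnorm (1c - y) < d] by apply/nbhs_rnormP; exists d.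
  by move=> /cv[i _ /(_ i (lexx_ i)) /=]; rewrite cmul1r => ?; exists (e i).
have pos1 : cpos (1c : A) by exists 1c; rewrite cstar1 cmul1l.
have pos0 : cpos (0 : A) by exists 0; rewrite cstar0 cmul0l.
split => //; exists unit, (fun _ _ => True), (fun=> 1c); split; first by [].
- by split => // _ _; exists tt.
- split; [by []|by []| |by move=> _ _ _; rewrite subrr].
  by move=> _; exact: rnorm1_le1.
- by move=> a; split=> U /nbhs_singleton Ua; exists tt => // i _ /=;
    rewrite ?cmul1l ?cmul1r.
Qed.

Lemma cstar_subalgebra_scalars : cstar_subalgebra (scalars A).
Proof.
have [one0|nz] := pselect ((1c : A) = 0).
  have all0 (x : A) : x = 0 by exact: trivial_algebra.
  have S (x : A) : scalars A x by exists 0 => //; rewrite scale0r (all0 x).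
  by split => //; apply/closed_rnorm => x _; exact: S.
(* closedness: the scalars are the [x] with [x = phi x * 1], for any state [phi] *)
have [phi sphi] := exists_state nz.
have pL := state_scalar sphi.
have S x : scalars A x <-> x = phi x *: 1c.
  split=> [[k _ <-]|->]; last by exists (phi x).
  by rewrite functionalZ // (state_one sphi) mulr1.
split.
- by exists 0 => //; rewrite scale0r.
- by move=> _ _ [k _ <-] [l _ <-]; exists (k + l) => //; rewrite scalerDl.
- by move=> k _ [l _ <-]; exists (k * l) => //; rewrite scalerA.
- by move=> _ _ [k _ <-] [l _ <-]; exists (k * l) => //; rewrite cmulZl cmul1l scalerA.
- by move=> _ [k _ <-]; exists (k^*) => //; rewrite cstarZ cstar1.
- apply/closed_rnorm => x approx; apply/S; apply/eqP; rewrite -subr_eq0.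
  apply/eqP/rnorm_eq0/eqP; rewrite eq_le rnorm_ge0 andbT; apply/ler_addgt0Pl => e e0.
  have [|y /S Sy xy] := approx (e / 2); first by rewrite divr_gt0.
  have -> : x - phi x *: 1c = (x - y) + phi (y - x) *: 1c.
    by rewrite functionalB // scalerBl -Sy addrA subrK.
  have := rnormD (x - y) (phi (y - x) *: 1c); rewrite rnormZ.
  have := state_le sphi (y - x); rewrite (rnormC y).
  have := rnorm1_le1 A; have := rnorm_ge0 (1c : A); have := cabs_ge0 (phi (y - x)).
  nra.
Qed.

Lemma abelian_scalars : abelian (scalars A).
Proof.
by move=> _ _ [k _ <-] [l _ <-]; rewrite !cmulZl !cmulZr !scalerA mulrC.
Qed.

Lemma scalars_one : scalars A 1c.
Proof. by exists 1 => //; rewrite scale1r. Qed.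

Lemma compact_state : compact (state A : set {ptws A -> cplx R}).
Proof.
apply: (@compact_ptws _ _ _ (@rnorm R A)); last first.
  by move=> phi a sphi; exact: state_le.
apply: closed_ptws => f approx.
apply: functional_one_state.
- move=> k x y; apply: (@cabs_small_eq _ _ _ (2 + cabs k)) => e e0.
  have [g gS fg] := approx [:: x; y; k *: x + y] e e0.
  have gz : g (k *: x + y) = k * g x + g y by exact: state_scalar.
  set z := k *: x + y in fg gz *.
  have -> : f z - (k * f x + f y) = (f z - g z) + (k * (g x - f x) + (g y - f y)).
    by rewrite gz; ring.
  apply: le_trans (cabsD _ _) _.
  have := cabsD (k * (g x - f x)) (g y - f y); rewrite cabsM.
  rewrite (cabsC (g x)) (cabsC (g y)).
  have fx : cabs (f x - g x) < e by apply: fg; rewrite !inE eqxx.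
  have fy : cabs (f y - g y) < e by apply: fg; rewrite !inE eqxx orbT.
  have fz : cabs (f z - g z) < e by apply: fg; rewrite !inE eqxx !orbT.
  have := cabs_ge0 k; nra.
- move=> a; have approx1 e : 0 < e -> exists2 z, 0 <= z & cabs (f (cstar a *c a) - z) < e.
    move=> e0; have [g gS fg] := approx [:: cstar a *c a] e e0.
    by exists (g (cstar a *c a)); [exact: state_ge0|exact/fg/mem_head].
  move: (f _) approx1 => w approx1; apply/cge0P; split.
    apply/eqP; rewrite -normr_eq0 eq_le normr_ge0 andbT; apply/ler_addgt0Pl => e.
    move=> /approx1[z /cge0P[z0 _] wz]; rewrite addr0.
    have -> : complex.Im w = complex.Im (w - z).
      by case: (w) (z) z0 => [? ?] [? ?] /= ->; rewrite subr0.
    exact: ltW (le_lt_trans (im_le_cabs _) wz).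
  apply/ler_addgt0Pl => e /approx1[z /cge0P[_ z0] wz].
  have := le_lt_trans (re_le_cabs _) wz.
  by rewrite reB ltr_norml => /andP[]; lra.
- apply: (@cabs_small_eq _ _ _ 1) => e e0.
  have [g gS fg] := approx [:: 1c] e e0.
  by rewrite -(state_one gS) mul1r ltW //; apply: fg; exact: mem_head.
Qed.

End Topographies.
(** * The metric and the weak* topology on states *)

(** Sort the points by the cell of length [e] in which the value of one of the functions
    falls, and recurse on the other functions in each cell. *)
Lemma finite_sample (R : realType) (T : Type) (D e : R) : 0 < e ->
  forall (n : nat) (f : nat -> T -> R) (X : set T),
  (forall i a, X a -> `|f i a| <= D) ->
  exists F : set T, [/\ finite_set F, F `<=` X &
    forall a, X a -> exists2 b, F b & forall i, (i < n)%N -> `|f i a - f i b| < e].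
Proof.
move=> e0; elim=> [|n IH] f X fD.
  have [[a0 Xa0]|X0] := pselect (X !=set0); last first.
    by exists set0; split => // a Xa; case: X0; exists a.
  by exists [set a0]; split => [|_ ->|a _] //; exists a0.
pose cell (k : nat) := [set a | X a /\ k%:R * e <= f n a + D < k.+1%:R * e].
have IHk k : exists F : set T, [/\ finite_set F, F `<=` cell k &
    forall a, cell k a -> exists2 b, F b & forall i, (i < n)%N -> `|f i a - f i b| < e].
  by apply: IH => i a [Xa _]; exact: fD.
have [F FP] := choice IHk.
pose K := (Num.truncn (2 * D / e)).+1.
exists (\bigcup_(k in `I_K) F k); split.
- by apply: bigcup_finite => // k _; have [] := FP k.
- by move=> b [k _ Fb]; have [_ FX _] := FP k; have [] := FX b Fb.
- move=> a Xa; pose k := Num.truncn ((f n a + D) / e).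
  have := fD n a Xa; rewrite ler_norml => /andP[fl fu].
  have q0 : 0 <= (f n a + D) / e by rewrite divr_ge0 ?(ltW e0) //; lra.
  have /andP[k1 k2] := truncn_itv q0.
  have cka : cell k a by split => //; rewrite -ler_pdivlMr // -ltr_pdivrMr // k1.
  have [_ Fcell Fk] := FP k; have [b Fb bP] := Fk a cka.
  exists b.
    exists k => //; rewrite /= /K ltnS; apply: le_truncn.
    rewrite ler_pM2r ?invr_gt0 //; lra.
  move=> i; rewrite ltnS leq_eqVlt => /predU1P[->|]; last exact: bP.
  have [_ /andP[b1 b2]] := Fcell b Fb; have [_ /andP[a1 a2]] := cka.
  rewrite -natr1 mulrDl mul1r in a2 b2.
  rewrite ltr_norml; apply/andP; split; lra.
Qed.

Section Metric.
Variables (R : realType) (A : unitalCStarAlgType (cplx R)) (L : lipschitz_pair A).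
Implicit Types (a b : A) (phi psi : A -> cplx R) (S : set (A -> cplx R)) (e : R).

Lemma quotient_norm_le a (k : cplx R) : quotient_norm a <= rnorm (a + k *: 1c).
Proof.
apply: ge_inf; last by exists k.
by exists 0 => _ [l _ <-]; exact: rnorm_ge0.
Qed.

Lemma quotient_norm_lt a e : quotient_norm a < e ->
  exists k : cplx R, rnorm (a + k *: 1c) < e.
Proof.
move=> /inf_lt[|_ [k _ <-] ke]; last by exists k.
by exists (rnorm (a + 0 *: 1c)), 0.
Qed.

Lemma lip_ball0 : lip_ball L 0.
Proof.
split; first exact: ldom0.
by rewrite -(scale0r (0 : A)) -of_real0 lipZ ?normr0 ?mul0r //; exact: ldom0.
Qed.

Lemma le_mk phi psi a : lip_ball L a -> ((cabs (phi a - psi a))%:E <= mk L phi psi)%E.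
Proof. by move=> La; apply: ereal_sup_ubound; exists a. Qed.

Lemma mk_le phi psi (r : R) : (forall a, lip_ball L a -> cabs (phi a - psi a) <= r) ->
  (mk L phi psi <= r%:E)%E.
Proof. by move=> H; apply: ge_ereal_sup => _ [a La <-]; rewrite lee_fin H. Qed.

Lemma mk_lt phi psi e : (mk L phi psi < e%:E)%E ->
  exists2 r, r < e & forall a, lip_ball L a -> cabs (phi a - psi a) <= r.
Proof.
have := @le_mk phi psi; case: (mk L phi psi) => [r le|//|le _].
  by rewrite lte_fin => re; exists r => // a /le; rewrite lee_fin.
by have := le 0 lip_ball0.
Qed.

Lemma mk_lt_ldom phi psi e b : scalar phi -> scalar psi -> ldom L b ->
  (mk L phi psi < e%:E)%E -> cabs (phi b - psi b) <= (lip L b + 1) * e.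
Proof.
move=> pL qL db /mk_lt[r re H].
have b0 := lip_ge0 db; have b1 : 0 < lip L b + 1 by lra.
pose c := of_real (lip L b + 1)^-1 *: b.
have cb : lip_ball L c.
  split; first exact: ldomZ.
  by rewrite lipZ // gtr0_norm ?invr_gt0 // ler_pdivrMl // mulr1 lerDl.
have := H c cb; rewrite !functionalZ // -mulrBr cabsM cabs_of_real.
rewrite gtr0_norm ?invr_gt0 // ler_pdivrMl // => /le_trans; apply.
by rewrite ler_pM2l // ltW.
Qed.

Lemma finite_diameterS S S' : S `<=` S' -> finite_diameter L S' -> finite_diameter L S.
Proof.
move=> SS'; apply: le_lt_trans; apply: ereal_sup_le.
by move=> _ [phi Sphi [psi Spsi <-]]; exists phi; [exact: SS'|exists psi; [exact: SS'|]].
Qed.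

(** The domain of the seminorm is dense, and on it the metric controls the values. *)
Lemma mk_control_sa a e : sa A a -> 0 < e -> exists2 d : R, 0 < d &
  forall phi psi, state A phi -> state A psi -> (mk L phi psi < d%:E)%E ->
    cabs (phi a - psi a) < e.
Proof.
move=> sa_a e0; have e4 : 0 < e / 4 by rewrite divr_gt0.
have [b db ab] := (closure_rnorm (ldom L) a).1 (@ldom_dense _ _ L _ sa_a) _ e4.
have b1 : 0 < lip L b + 1 by have := lip_ge0 db; lra.
exists (e / 4 / (lip L b + 1)); first by rewrite divr_gt0.
move=> phi psi sphi spsi.
move=> /(mk_lt_ldom (state_scalar sphi) (state_scalar spsi) db).
rewrite mulrCA divff ?gt_eqF // mulr1 => pb.
have -> : phi a - psi a = phi (a - b) + (phi b - psi b) - psi (a - b).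
  by rewrite !functionalB; [ring|exact: state_scalar..].
have := cabsD (phi (a - b) + (phi b - psi b)) (- psi (a - b)).
have := cabsD (phi (a - b)) (phi b - psi b).
have := state_le sphi (a - b); have := state_le spsi (a - b).
rewrite cabsN; lra.
Qed.

Lemma mk_control a e : 0 < e -> exists2 d : R, 0 < d &
  forall phi psi, state A phi -> state A psi -> (mk L phi psi < d%:E)%E ->
    cabs (phi a - psi a) < e.
Proof.
move=> e0; have e2 : 0 < e / 2 by rewrite divr_gt0.
have [d1 d10 H1] := mk_control_sa (sa_hre a) e2.
have [d2 d20 H2] := mk_control_sa (sa_him a) e2.
exists (Num.min d1 d2); first by rewrite lt_min d10.
move=> phi psi sphi spsi lt.
have lt1 : (mk L phi psi < d1%:E)%E by rewrite (lt_le_trans lt) // lee_fin ge_min lexx.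
have lt2 : (mk L phi psi < d2%:E)%E by rewrite (lt_le_trans lt) // lee_fin ge_min lexx orbT.
have -> : phi a - psi a = (phi (hre a) - psi (hre a)) + 'i * (phi (him a) - psi (him a)).
  have pL := state_scalar sphi; have qL := state_scalar spsi.
  rewrite {1 2}(hre_him a) (functionalD pL) (functionalD qL).
  by rewrite (functionalZ pL) (functionalZ qL); ring.
have := H1 _ _ sphi spsi lt1; have := H2 _ _ sphi spsi lt2.
have := cabsD (phi (hre a) - psi (hre a)) ('i * (phi (him a) - psi (him a))).
rewrite cabsM cabs_i; lra.
Qed.

Lemma mk_control_seq (s : seq A) e : 0 < e -> exists2 d : R, 0 < d &
  forall phi psi, state A phi -> state A psi -> (mk L phi psi < d%:E)%E ->
    forall a, a \in s -> cabs (phi a - psi a) < e.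
Proof.
move=> e0; elim: s => [|a s [d d0 H]]; first by exists 1.
have [d' d'0 H'] := mk_control a e0.
exists (Num.min d d'); first by rewrite lt_min d0.
move=> phi psi sphi spsi lt b; rewrite inE => /predU1P[->|bs].
  by apply: H' => //; rewrite (lt_le_trans lt) // lee_fin ge_min lexx orbT.
by apply: H => //; rewrite (lt_le_trans lt) // lee_fin ge_min lexx.
Qed.

(** A weak* neighbourhood constrains finitely many values, each controlled by the metric. *)
Lemma weak_star_open_mk_open S U : S `<=` state A ->
  weak_star_open S U -> mk_open L S U.
Proof.
move=> Sst [V oV ->] phi [Vphi Sphi].
have [s [e [e0 sV]]] := (nbhs_ptwsP (phi : {ptws A -> cplx R}) V).1
  (open_nbhs_nbhs (conj oV Vphi)).
have [d d0 H] := mk_control_seq s e0.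
exists d => // psi Spsi lt; split => //; apply: sV => a as_.
by apply: H => //; exact: Sst.
Qed.

(** Under total boundedness modulo scalars, the values at a finite net control the
    metric, since two states differ by at most [2 e] on an element of quotient norm
    less than [e]. *)
Lemma compact_quantum_metrizes S : compact_quantum_metric_space L ->
  S `<=` state A -> mk_metrizes_weak_star L S.
Proof.
move=> [_ tb] Sst U US; split; last exact: weak_star_open_mk_open.
move=> oU.
pose V := \bigcup_(W in [set W : set {ptws A -> cplx R} | open W /\ W `&` S `<=` U]) W.
exists V; first by apply: bigcup_open => W [].
apply/seteqP; split=> [phi Uphi|phi [[W [_ WU] Wphi] Sphi]]; last exact: WU.
split; last exact: US.
have [e e0 eU] := oU _ Uphi.
have e4 : 0 < e / 4 by rewrite divr_gt0.
have [F /finite_seqP[s FE] Fnet] := tb _ e4.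
have := nbhs_ptws_ball (phi : {ptws A -> cplx R}) s e4.
rewrite nbhsE => -[W [oW Wphi] Wb].
exists W => //; split => // psi [Wpsi Spsi]; apply: eU => //.
have /Wb near := Wpsi.
suff : (mk L phi psi <= (e / 4 + e / 4 + e / 4)%:E)%E.
  by move=> /le_lt_trans; apply; rewrite lte_fin; lra.
apply: mk_le => a La.
have [b Fb /= /quotient_norm_lt[k ke]] := Fnet a La.
have sphi : state A phi by apply: Sst; exact: US.
have spsi : state A psi by exact: Sst.
have nb : cabs (phi b - psi b) < e / 4.
  by apply: near; move: Fb; rewrite FE.
have pL := state_scalar sphi; have qL := state_scalar spsi.
set c := a - b + k *: 1c in ke.
have -> : phi a - psi a = phi c + (phi b - psi b) - psi c.
  rewrite /c !(functionalD pL) !(functionalD qL) !(functionalZ pL) !(functionalZ qL).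
  by rewrite (functionalN pL) (functionalN qL) (state_one sphi) (state_one spsi); ring.
have := cabsD (phi c + (phi b - psi b)) (- psi c).
have := cabsD (phi c) (phi b - psi b).
have := state_le sphi c; have := state_le spsi c.
rewrite cabsN; lra.
Qed.

End Metric.
(** * Separability *)

Section Separability.
Variables (R : realType) (A : unitalCStarAlgType (cplx R)) (L : lipschitz_pair A).
Implicit Types (a b x : A) (e : R).

Lemma rat_near (t e : R) : 0 < e -> exists q : rat, `|t - ratr q| < e.
Proof.
move=> e0; have [|q] := @rat_in_itvoo R (t - e) (t + e); first by lra.
rewrite in_itv /= => /andP[q1 q2]; exists q; rewrite ltr_norml; lra.
Qed.

Variable E : set A.
Hypothesis netE : forall e, 0 < e -> forall a, lip_ball L a ->
  exists2 b, E b & quotient_norm (a - b) < e.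

(** An element of the domain, divided by a rational number above its seminorm, lies in
    the unit ball of the seminorm, hence near the net modulo scalars. *)
Lemma sa_near_net a e : sa A a -> 0 < e ->
  exists (p : rat) (b : A) (k : cplx R), E b /\
    rnorm (a - (of_real (ratr p) *: b + k *: 1c)) < e.
Proof.
move=> sa_a e0; have e2 : 0 < e / 2 by rewrite divr_gt0.
have [y dy ay] := (closure_rnorm (ldom L) a).1 (@ldom_dense _ _ L _ sa_a) _ e2.
have y0 := lip_ge0 dy.
have [p] := @rat_near (lip L y + 1) 1 ltr01.
rewrite ltr_norml => /andP[_ py].
have p0 : 0 < ratr p :> R by lra.
have lc : lip_ball L (of_real (ratr p)^-1 *: y).
  split; first exact: ldomZ.
  rewrite lipZ // gtr0_norm ?invr_gt0 // ler_pdivrMl // mulr1; lra.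
have [b Eb /quotient_norm_lt[k ke]] := netE (divr_gt0 e2 p0) lc.
exists p, b, (- (of_real (ratr p) * k)); split => //.
rewrite (le_lt_trans (rnorm_trans y _ _)) // (splitr e) ltrD //.
have -> : y - (of_real (ratr p) *: b + - (of_real (ratr p) * k) *: 1c) =
    of_real (ratr p) *: (of_real (ratr p)^-1 *: y - b + k *: 1c).
  rewrite scalerDr scalerBr !scalerA -of_realM mulfV ?gt_eqF // scale1r.
  by rewrite scaleNr opprD opprK addrA.
by rewrite rnormZr gtr0_norm // -ltr_pdivlMl // mulrC.
Qed.

(** The elements [p b + i q c + (u + i v)] with rational [p], [q], [u], [v] and with
    [b], [c] in the net are dense. *)
Lemma separable_of_net : countable E -> separable A.
Proof.
move=> cE.
pose f (z : (A * A) * ((rat * rat) * (rat * rat))) : A :=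
  of_real (ratr z.2.1.1) *: z.1.1 + 'i *: (of_real (ratr z.2.1.2) *: z.1.2) +
  (of_real (ratr z.2.2.1) + 'i%C * of_real (ratr z.2.2.2)) *: 1c.
exists (f @` ((E `*` E) `*` setT)).
  apply: sub_countable (card_image_le _ _) _; apply: countableX; first exact: countableX.
  exact: countableP.
move=> O [x Ox] oO.
have /nbhs_rnormP[e e0 xO] : nbhs x O by exact: open_nbhs_nbhs.
have e5 : 0 < e / 5 by rewrite divr_gt0.
have [p [b [k [Eb hb]]]] := sa_near_net (sa_hre x) e5.
have [q [c [l [Ec hc]]]] := sa_near_net (sa_him x) e5.
pose w : cplx R := k + 'i * l.
have [u hu] := rat_near (re w) e5.
have [v hv] := rat_near (complex.Im w) e5.
pose z : (A * A) * ((rat * rat) * (rat * rat)) := ((b, c), ((p, q), (u, v))).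
exists (f z); split; last by exists z.
apply: xO.
pose r : cplx R := of_real (ratr u) + 'i%C * of_real (ratr v).
set P := (_ *: b + k *: 1c) in hb; set Q := (_ *: c + l *: 1c) in hc.
have PQ : P + 'i *: Q = f z + (w - r) *: 1c.
  have -> : f z = of_real (ratr p) *: b + 'i *: (of_real (ratr q) *: c) + r *: 1c by [].
  rewrite /P /Q scalerDr (scalerA 'i l) addrACA -scalerDl scalerBl.
  by rewrite -[RHS]addrA (addrC (r *: 1c)) subrK.
have -> : x - f z = (hre x - P) + 'i *: (him x - Q) + (w - r) *: 1c.
  by rewrite scalerBr addrACA -opprD -hre_him PQ (opprD (f z)) addrA subrK.
have := rnormD ((hre x - P) + 'i *: (him x - Q)) ((w - r) *: 1c).
have := rnormD (hre x - P) ('i *: (him x - Q)).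
have wr : rnorm ((w - r) *: (1c : A)) <= cabs (w - r).
  by rewrite rnormZ ler_piMr ?cabs_ge0 // rnorm1_le1.
rewrite [rnorm ('i *: _)]rnormZ cabs_i.
have := cabs_le_reim (w - r).
have -> : re (w - r) = re w - ratr u by rewrite reB /r /re /=; ring.
have -> : complex.Im (w - r) = complex.Im w - ratr v.
  by rewrite /r; case: (w) => ? ?; rewrite /=; ring.
lra.
Qed.

End Separability.

(** * Compactness and local compactness *)

(* The open-cover form of compactness asks for a base point. *)
HB.instance Definition _ (R : realType) (I : Type) :=
  isPointed.Build {ptws I -> cplx R} (fun=> 0).

Section Equivalence.
Variables (R : realType) (A : unitalCStarAlgType (cplx R)) (L : lipschitz_pair A).
Implicit Types (a b : A) (M : set A) (e : R).

Lemma compact_quantum_separable : compact_quantum_metric_space L -> separable A.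
Proof.
move=> [_ tb].
have net n : exists F : set A, finite_set F /\
    lip_ball L `<=` \bigcup_(b in F) [set a | quotient_norm (a - b) < n.+1%:R^-1].
  by have [|F finF netF] := tb n.+1%:R^-1; [rewrite invr_gt0|exists F].
have [F FP] := choice net.
apply: (@separable_of_net _ _ L (\bigcup_n F n)); last first.
  by apply: bigcup_countable => // n _; apply: finite_set_countable; case: (FP n).
move=> e e0 a La; pose n := Num.truncn e^-1.
have [_ /(_ a La)[b Fb /= ab]] := FP n.
exists b; first by exists n.
rewrite (lt_trans ab) // invf_plt ?posrE //; exact: truncnS_gt.
Qed.

Lemma compact_quantum_locally_compact M : compact_quantum_metric_space L ->
  cstar_subalgebra M -> abelian M -> M 1c ->
  quantum_locally_compact_separable_metric_space L M.
Proof.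
move=> cq hM abM M1; split; last exact: compact_quantum_separable.
split; first exact/topographicP.
- by move=> K _; apply: finite_diameterS cq.1 => phi [].
- by move=> S [Sst _]; exact: compact_quantum_metrizes.
Qed.

Section Converse.
Variable N : comm_subalg A.
Hypothesis nontrivial : (1c : A) <> 0.
Hypothesis locally_compact : quantum_locally_compact_metric_space L (comm_set N).
Local Notation K := (spectrum (comm_set N)).

Lemma states_on_spectrum : states_on K = state A.
Proof.
apply/seteqP; split=> [phi []//|phi sphi]; split => //.
by rewrite indicatorT state_one.
Qed.

(** For [K] the whole spectrum, cutting down by the indicator of [K] is the identity. *)
Lemma tame_state : tame L (comm_set N) (state A).
Proof.
split => //; have [mu smu] := exists_state nontrivial.
exists mu; first by exists K; [exact: compact_spectrumT|rewrite states_on_spectrum].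
move=> e e0; exists K; first exact: compact_spectrumT.
move=> K' [K'K _] KK'; have -> : K' = K by apply/seteqP.
apply: (@le_lt_trans _ _ 0%:E); last by rewrite lte_fin.
apply: ge_ereal_sup => _ [a _ [phi _ <-]].
by rewrite arens_indicatorT subrr cabs0.
Qed.

Lemma state_finite_diameter : finite_diameter L (state A).
Proof.
have [_ reg _] := locally_compact.
by rewrite -states_on_spectrum; exact: reg (compact_spectrumT N).
Qed.

Lemma state_bounded : exists D : R, forall phi psi a,
  state A phi -> state A psi -> lip_ball L a -> cabs (phi a - psi a) <= D.
Proof.
have := state_finite_diameter; rewrite /finite_diameter.
set s := ereal_sup _ => s_fin.
have le phi psi a : state A phi -> state A psi -> lip_ball L a ->
    ((cabs (phi a - psi a))%:E <= s)%E.
  move=> sphi spsi La; apply: le_trans (le_mk _ _ La) _.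
  by apply: ereal_sup_ubound; exists phi => //; exists psi.
case: s s_fin le => [D|//|] _ le.
  by exists D => phi psi a sphi spsi La; have := le phi psi a sphi spsi La.
exists 0 => phi psi a sphi spsi La; by have := le phi psi a sphi spsi La.
Qed.

Lemma mk_open_ball phi e : mk_open L (state A)
  [set psi | state A psi /\ (mk L phi psi < e%:E)%E].
Proof.
move=> psi [spsi /mk_lt[r re rP]]; exists ((e - r) / 2).
  by rewrite divr_gt0 // subr_gt0.
move=> chi schi /mk_lt[t te tP]; split => //.
apply: (@le_lt_trans _ _ (r + t)%:E); last by rewrite lte_fin; lra.
apply: mk_le => a La; have := rP a La; have := tP a La.
have := cabsD (phi a - psi a) (psi a - chi a); rewrite addrA subrK; lra.
Qed.

(** Metric balls are weak* open, so finitely many cover the weak* compact state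
    space. *)
Lemma finite_state_net e : 0 < e -> exists (n : nat) (phi : nat -> A -> cplx R),
  (forall i, state A (phi i)) /\
  (forall psi, state A psi -> exists2 i, (i < n)%N & (mk L (phi i) psi < e%:E)%E).
Proof.
move=> e0; have [_ _ met] := locally_compact.
have ex phi : exists V : set {ptws A -> cplx R}, open V /\
    [set psi | state A psi /\ (mk L phi psi < e%:E)%E] = V `&` state A.
  have [|V oV VE] := (met _ tame_state _ _).1 (@mk_open_ball phi e); last by exists V.
  by move=> psi [].
have [V VP] := choice ex.
have cs := eq_ind _ (fun P : set (set {ptws A -> cplx R}) => P (state A))
  (@compact_state R A) _ (@compact_cover {ptws A -> cplx R}).
have [|phi sphi|D' D's cov] := cs _ (state A : set {ptws A -> cplx R}) V.
- by move=> phi _; case: (VP phi).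
- exists phi => //.
  have [_ VE] := VP phi.
  suff : (V phi `&` state A) phi by case.
  rewrite -VE; split => //; apply: (@le_lt_trans _ _ 0%:E); last by rewrite lte_fin.
  by apply: mk_le => a _; rewrite subrr cabs0.
have /finite_seqP[s sE] := finite_fset D'.
have s_state x : x \in s -> state A x.
  by move=> xs; apply/set_mem/D's; exact: (eq_ind_r (fun P : set _ => P x) xs sE).
have [phi0 sphi0] := exists_state nontrivial.
exists (size s), (nth phi0 s); split=> [i|psi spsi].
  have [lt|ge] := ltnP i (size s); last by rewrite nth_default.
  exact/s_state/mem_nth.
have [phi Dphi Vpsi] := cov psi spsi.
have phis : phi \in s by move: Dphi; rewrite sE.
exists (index phi s); first by rewrite index_mem.
rewrite (nth_index phi0 phis).
have [_ VE] := VP phi; have : (V phi `&` state A) psi by split.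
by rewrite -VE => -[].
Qed.

(** On the unit ball of the seminorm, all states are [e]-close to finitely many states
    [phi i], and the differences [phi i - phi0] are bounded.  So the ball has a finite
    set of samples [b] for which every [a] has a [b] with all
    [(phi i - phi0) (a - b)] small; then every state is small at
    [a - b - phi0 (a - b)], and states compute the norm of that element. *)
Lemma lip_ball_totally_bounded e : 0 < e -> exists2 F : set A, finite_set F &
  lip_ball L `<=` \bigcup_(b in F) [set a | quotient_norm (a - b) < e].
Proof.
move=> e0; have e4 : 0 < e / 4 by rewrite divr_gt0.
have [n [phi [sphi phi_net]]] := finite_state_net e4.
have [phi0 sphi0] := exists_state nontrivial.
have [D DP] := state_bounded.
pose f i a := re (phi i a - phi0 a).
have fD i a : lip_ball L a -> `|f i a| <= D.
  by move=> La; rewrite (le_trans (re_le_cabs _)) // DP.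
have [F [finF FL FP]] := finite_sample e4 n fD.
exists F => // a La; have [b Fb fab] := FP a La.
have Lb : lip_ball L b by exact: FL.
have sa_a : sa A a by apply: (@ldom_sa _ _ L); case: La.
have sa_b : sa A b by apply: (@ldom_sa _ _ L); case: Lb.
have sab : sa A (a - b) by exact: saB.
exists b => //=.
pose c := a - b + (- phi0 (a - b)) *: 1c.
have [p0L p00] := (state_scalar sphi0, state_ge0 sphi0).
have sc : sa A c.
  apply: saD => //; rewrite /sa /= (functional_sa p0L p00 sab) -of_realN.
  exact: sa_sc.
have [psi spsi cpsi] := state_norming nontrivial sc.
apply: le_lt_trans (quotient_norm_le _ (- phi0 (a - b))) _.
apply: le_lt_trans cpsi _.
have [i il /mk_lt[r re rP]] := phi_net psi spsi.
have [piL pi0] := (state_scalar (sphi i), state_ge0 (sphi i)).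
have psiL := state_scalar spsi.
have -> : psi c = - (phi i a - psi a) + (phi i b - psi b) +
    (phi i (a - b) - phi0 (a - b)).
  rewrite /c (functionalD psiL) (functionalZ psiL) (state_one spsi) mulr1.
  by rewrite (functionalB psiL) (functionalB piL); ring.
have -> : phi i (a - b) - phi0 (a - b) = of_real (f i a - f i b).
  rewrite (functional_sa piL pi0 sab) (functional_sa p0L p00 sab) -of_realB.
  congr of_real; rewrite /f !functionalB // !reB; lra.
have := cabsD (- (phi i a - psi a) + (phi i b - psi b)) (of_real (f i a - f i b)).
have := cabsD (- (phi i a - psi a)) (phi i b - psi b).
rewrite cabsN cabs_of_real; have := fab i il; have := rP a La; have := rP b Lb; lra.
Qed.

End Converse.

Lemma locally_compact_compact_quantum M : cstar_subalgebra M -> abelian M -> M 1c ->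
  quantum_locally_compact_metric_space L M -> compact_quantum_metric_space L.
Proof.
move=> hM abM M1; pose N := CommSubalg hM abM M1.
rewrite -[M]/(comm_set N) => lc.
have [one0|nz] := pselect ((1c : A) = 0); last first.
  split; first exact: state_finite_diameter lc.
  by move=> e; exact: (lip_ball_totally_bounded nz lc).
have all0 (x : A) : x = 0 by exact: trivial_algebra.
split.
  rewrite /finite_diameter (_ : [set _ | _ in _ & _ in _] = set0) ?ereal_sup0 //.
  apply/seteqP; split=> // r [phi sphi _]; have := state_one sphi.
  rewrite one0 functional0; last exact: state_scalar.
  by move=> /eqP; rewrite eq_sym oner_eq0.
move=> e e0; exists [set 0] => // a _; exists 0 => //=.
rewrite (le_lt_trans (quotient_norm_le _ 0)) //.
by rewrite (all0 (_ + _)) rnorm0.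
Qed.

End Equivalence.

Theorem theorem4p2 (R : realType) (A : unitalCStarAlgType (cplx R))
    (L : lipschitz_pair A) :
  (forall M : set A, cstar_subalgebra M -> abelian M ->
     (topographic M <-> M 1c)) /\
  [<-> compact_quantum_metric_space L ;
       quantum_locally_compact_metric_space L (scalars A) ;
       forall M : set A, cstar_subalgebra M -> abelian M -> M 1c ->
         quantum_locally_compact_separable_metric_space L M ;
       exists M : set A, [/\ cstar_subalgebra M, abelian M, M 1c &
         quantum_locally_compact_metric_space L M] ;
       forall h : A, strictly_positive h ->
         quantum_locally_compact_separable_metric_space L (cstar_generated h) ;
       exists h : A, strictly_positive h /\
         quantum_locally_compact_metric_space L (cstar_generated h)].
Proof.
split; first exact: topographicP.
have hS := cstar_subalgebra_scalars A; have abS := @abelian_scalars R A.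
have S1 := scalars_one A.
tfae.
- by move=> cq; have [] := compact_quantum_locally_compact cq hS abS S1.
- move=> /(locally_compact_compact_quantum hS abS S1) cq M hM abM M1.
  exact: compact_quantum_locally_compact.
- by move=> H; exists (scalars A); split => //; have [] := H _ hS abS S1.
- move=> [M [hM abM M1 /(locally_compact_compact_quantum hM abM M1) cq]] h hpos.
  have [hH abH H1] := cstar_generatedP hpos.
  exact: compact_quantum_locally_compact.
- move=> H; exists 1c; split; first exact: strictly_positive_unit.
  by have [] := H _ (strictly_positive_unit A).
- move=> [h [/cstar_generatedP[hH abH H1]]].
  exact: locally_compact_compact_quantum.
Qed.
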